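(* Let $y$ be the solution of $\dot y(t)=f(y(t))$, $t\in[t_0,T]$, $y(t_0)=y_0\in\mathbb R^m$, let $s\ge1$, $h=(T-t_0)/N$, $t_n=t_0+nh$, and let $u_n$, $y_n=u_n(h)$, $n=1,\dots,N$, be the polynomial approximations of degree at most $s$ and the grid values obtained from the quadrature-discretized truncated Legendre expansion with $k$ abscissae and weights $(c_i,b_i)$ (see context). Assume that the quadrature formula has order $q\ge 2s$. Then, with $\hat\sigma_n(ch):=y(t_{n-1}+ch)$, for $n=1,\dots,N$ one has $$y(t_n)-y_n=y(t_{n-1})-y_{n-1}+O(h^{2s+1}),\qquad \max_{c\in[0,1]}|\hat\sigma_n(ch)-u_n(ch)|=O(h^{s+1}).$$
   Context: $f:\mathbb R^m\to\mathbb R^m$ is assumed suitably regular (as smooth as needed) and $y$ is the solution on $[t_0,T]$. $|\cdot|$ is any vector norm on $\mathbb R^m$. $\{P_j\}_{j\ge0}$ is the orthonormal Legendre basis on $[0,1]$: $P_j$ is a polynomial of degree $j$, $\int_0^1P_i(x)P_j(x)\,dx=\delta_{ij}$, $P_0\equiv1$. $(c_i,b_i)_{i=1}^k$ are the (distinct) abscissae and weights of an interpolatory quadrature formula on $[0,1]$; it has order $q$ if $\sum_{i=1}^kb_ip(c_i)=\int_0^1p(x)\,dx$ for all polynomials $p$ of degree at most $q-1$. For a function $u_n$ on $[0,h]$ set $\hat\gamma_j(u_n):=\sum_{i=1}^kb_iP_j(c_i)f(u_n(c_ih))$, $j=0,\dots,s-1$. The values $y_n$ and polynomials $u_n$ are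 defined successively for $n=1,\dots,N$, starting from $y_0$, by $$u_n(ch)=y_{n-1}+h\sum_{j=0}^{s-1}\int_0^cP_j(x)\,dx\,\hat\gamma_j(u_n),\quad c\in[0,1],\qquad y_n:=u_n(h)=y_{n-1}+h\hat\gamma_0(u_n)$$ (the stepsize $h$ being small enough for $u_n$ to be well defined). The $O(\cdot)$ symbols refer to $h=(T-t_0)/N\to0$, with constants uniform in $n$. *)

(* Defs.v *)
From mathcomp Require Export all_boot all_order all_algebra.
From mathcomp Require Export all_classical all_reals all_analysis.
Set Implicit Arguments.
Unset Strict Implicit.
Unset Printing Implicit Defensive.
Export Order.TTheory GRing.Theory Num.Theory.
Export numFieldNormedType.Exports.
Local Open Scope classical_set_scope.
Local Open Scope ring_scope.

(* An arbitrary vector norm, not tied to the max-norm `|x| that MathComp-Analysis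
   puts on 'rV[R]_m; the latter only provides the (norm-independent) topology
   used below for limits and differentiability. *)
Record vector_norm (R : realType) (m : nat) (nrm : 'rV[R]_m -> R) : Prop := {
  vector_norm0_eq0 : forall x, nrm x = 0 -> x = 0;
  vector_normZ : forall (a : R) x, nrm (a *: x) = `|a| * nrm x;
  vector_normD : forall x z, nrm (x + z) <= nrm x + nrm z }.

(* Class C^p on the whole space; as directional derivatives are linear in v
   when f is differentiable, this is the usual condition on partial
   derivatives. *)
Fixpoint class_C (R : realType) (m : nat) (p : nat) (f : 'rV[R]_m -> 'rV[R]_m)
    : Prop :=
  if p is p'.+1 then
    (forall x, differentiable f x) /\
    (forall v : 'rV[R]_m, class_C p' (fun x => 'D_v f x))
  else continuous f.

(* The quotient is taken along r in A, r != t, so that this is a one-sided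
   derivative at the end points when A is an interval. *)
Definition derivative_within (R : realType) (m : nat) (A : set R)
    (y : R -> 'rV[R]_m) (t : R) (l : 'rV[R]_m) : Prop :=
  (r - t)^-1 *: (y r - y t) @[r --> within A (dnbhs t)] --> l.

Definition ivp_solution (R : realType) (m : nat) (f : 'rV[R]_m -> 'rV[R]_m)
    (t0 T : R) (y0 : 'rV[R]_m) (y : R -> 'rV[R]_m) : Prop :=
  y t0 = y0 /\
  forall t, t0 <= t <= T -> derivative_within `[t0, T] y t (f (y t)).

Definition integral_poly (R : realType) (p : {poly R}) (t : R) : R :=
  \int[@lebesgue_measure R]_(x in `[0, t]) p.[x].

(* These conditions determine each P j up to its sign. *)
Record legendre_basis (R : realType) (P : nat -> {poly R}) : Prop := {
  legendre_size : forall j, size (P j) = j.+1;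
  legendre_orthonormal :
    forall i j, integral_poly (P i * P j) 1 = (i == j)%:R;
  legendre0 : P 0%N = 1 }.

Definition lagrange_poly (R : realType) (k : nat) (c : 'I_k -> R) (i : 'I_k)
    : {poly R} :=
  \prod_(j < k | j != i) ((c i - c j)^-1 *: ('X - (c j)%:P)).

Record interpolatory_quadrature (R : realType) (k : nat) (c b : 'I_k -> R)
    : Prop := {
  abscissae_distinct : injective c;
  abscissae_unit : forall i, 0 <= c i <= 1;
  weights_interpolatory : forall i, b i = integral_poly (lagrange_poly c i) 1 }.

Definition quadrature_order (R : realType) (k : nat) (c b : 'I_k -> R)
    (q : nat) : Prop :=
  forall p : {poly R}, (size p <= q)%N ->
    \sum_(i < k) b i * p.[c i] = integral_poly p 1.

Definition gamma_hat (R : realType) (m : nat) (f : 'rV[R]_m -> 'rV[R]_m)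
    (P : nat -> {poly R}) (k : nat) (c b : 'I_k -> R) (h : R)
    (v : R -> 'rV[R]_m) (j : nat) : 'rV[R]_m :=
  \sum_(i < k) (b i * (P j).[c i]) *: f (v (c i * h)).

(* [u n] matters on [0, h] only, where the second clause makes it a polynomial
   of degree at most s.  That clause is an implicit equation for [u n], which
   for a nonlinear f may have parasitic solutions running away to infinity as
   h -> 0 (e.g. f y = y ^+ 2, s = 1); the last clause, with rho fixed
   independently of h, singles out the solution branch near [yn n.-1]. *)
Record scheme_run (R : realType) (m : nat) (nrm : 'rV[R]_m -> R)
    (f : 'rV[R]_m -> 'rV[R]_m) (P : nat -> {poly R}) (s k : nat)
    (c b : 'I_k -> R) (rho h : R) (N : nat) (y0 : 'rV[R]_m)
    (yn : nat -> 'rV[R]_m) (u : nat -> R -> 'rV[R]_m) : Prop := {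
  run_init : yn 0%N = y0;
  run_poly : forall n, (1 <= n <= N)%N -> forall x, 0 <= x <= 1 ->
    u n (x * h) = yn n.-1 +
      h *: \sum_(j < s) integral_poly (P j) x *: gamma_hat f P c b h (u n) j;
  run_step : forall n, (1 <= n <= N)%N -> yn n = u n h;
  run_near : forall n, (1 <= n <= N)%N -> forall x, 0 <= x <= 1 ->
    nrm (u n (x * h) - yn n.-1) <= rho }.

Definition scheme_well_defined (R : realType) (m : nat) (nrm : 'rV[R]_m -> R)
    (f : 'rV[R]_m -> 'rV[R]_m) (P : nat -> {poly R}) (s k : nat)
    (c b : 'I_k -> R) (rho h : R) (N : nat) (y0 : 'rV[R]_m) : Prop :=
  (exists yn u, scheme_run nrm f P s c b rho h N y0 yn u) /\
  (forall yn u yn' u', scheme_run nrm f P s c b rho h N y0 yn u ->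
     scheme_run nrm f P s c b rho h N y0 yn' u' ->
     forall n, (1 <= n <= N)%N ->
       yn n = yn' n /\ forall x, 0 <= x <= 1 -> u n (x * h) = u' n (x * h)).

Definition is_maximum (R : realType) (A : set R) (M : R) : Prop :=
  A M /\ forall x, A x -> x <= M.

(* Main.v *)
From HB Require Import structures.
Require Import Defs.
From mathcomp Require Import ring lra zify.
Set Implicit Arguments.
Unset Strict Implicit.
Unset Printing Implicit Defensive.
Local Open Scope classical_set_scope.
Local Open Scope ring_scope.

(** The proof compares, on each step and with the rescaled time x in [0, 1],
    the exact solution u(x) = y(t_(n-1) + x h) with the polynomial v of the
    scheme. Their difference e solves
      e' = h (f(u) - f(v) + r),    r = f(v) - sum_(j < s) P_j gamma_j.

    Everything rests on the structure of the defect r. Along v, the function f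
    has an expansion f(v) = T + O(h^(2s)), where T is a polynomial in x whose
    coefficient of degree l is O(h^l) ([taylor_stage], a bootstrap between the
    regularity of f(v) and that of v'). Hence r agrees up to O(h^(2s)) with
    R(T) = T - sum_j Q(P_j T) P_j, where Q is the quadrature
    ([stage_defect]). Since Q integrates polynomials of degree less than 2 s
    exactly, R(x^i) = 0 for i < s, and the integral of x^l R(x^i) vanishes
    whenever l + i < 2 s ([quad_moments]). So r is O(h^s), and its integral
    against any polynomial W whose coefficients of degree l are O(h^l) is
    O(h^(2s)) ([int01_residual_small]).

    The first property gives |e| <= C (|e(0)| + h^(s+1)) on the whole step
    ([stage_error]). For the end of the step, f(u) - f(v) is linearized to
    Df(v) e + O(|e|^2), and e is paired with a polynomial approximation Z of
    the adjoint solution Z' = - h Z Df(v), with Z(1) a basis vector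
    ([approximate_adjoint]). In the derivative of Z.e the linear term cancels
    and h Z.r remains, whose integral is O(h^(2s+1)) by the second property.
    This yields |e(1) - e(0)| <= C h (|e(0)| + h^(2s)) ([step_error_coord]).
    Using polynomials Z avoids the variational equation, and only f is
    differentiated, never the flow.

    A discrete Gronwall argument turns the last bound into |e(0)| = O(h^(2s))
    uniformly over the grid ([run_error]); inserted in the two bounds it gives
    the two estimates of the theorem. The same bound keeps the numerical
    solution in a fixed ball, where f is Lipschitz, so that for small h every
    step is a contraction problem with a unique solution ([slopes_exist],
    [slopes_unique]). *)

(** * Antiderivatives of polynomials *)

Section Antiderivative.
Variable R : realType.
Implicit Types (p q : {poly R}) (a t : R).

(** The antiderivative vanishing at 0. The coefficient of degree 0 is
    a division by 0, hence 0, which avoids a case distinction. *)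
Definition prim p : {poly R} := \poly_(i < (size p).+1) (p`_i.-1 / i%:R).

Lemma coef_prim p i : (prim p)`_i = p`_i.-1 / i%:R.
Proof.
rewrite coef_poly; case: ltnP => // pi; case: i pi => [|i] pi.
  by rewrite invr0 mulr0.
by rewrite nth_default ?mul0r.
Qed.

Lemma size_prim p : (size (prim p) <= (size p).+1)%N.
Proof. exact: size_poly. Qed.

Lemma deriv_prim p : (prim p)^`() = p.
Proof.
apply/polyP => i; rewrite coef_deriv coef_prim /=.
by rewrite -[LHS]mulr_natr mulfVK // pnatr_eq0.
Qed.

Lemma prim_is_linear : linear prim.
Proof.
move=> a p q; apply/polyP => i.
by rewrite coefD coefZ !coef_prim coefD coefZ mulrDl mulrA.
Qed.
HB.instance Definition _ :=
  GRing.isLinear.Build R {poly R} {poly R} _ prim prim_is_linear.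

Lemma prim_horner0 p : (prim p).[0] = 0.
Proof. by rewrite horner_coef0 coef_prim invr0 mulr0. Qed.

Lemma integral_polyE p t : 0 <= t -> integral_poly p t = (prim p).[t].
Proof.
rewrite le_eqVlt => /predU1P[<-|t0]; rewrite /integral_poly.
  by rewrite prim_horner0 set_itv1 Rintegral_set1.
rewrite /Rintegral (@continuous_FTC2 _ _ (horner (prim p))) //.
- by rewrite prim_horner0 sube0.
- by apply: continuous_subspaceT => x; exact: continuous_horner.
- split=> [x _||]; first exact: derivable_horner.
  + by apply: cvg_at_right_filter; exact: continuous_horner.
  + by apply: cvg_at_left_filter; exact: continuous_horner.
- by move=> x _; rewrite -derivE deriv_prim.
Qed.

End Antiderivative.

(** * Mean value bound *)

Section MeanValue.
Variable R : realType.

Lemma within_continuous_comp (V W : normedModType R) (A : set R) (w : R -> V)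
    (g : V -> W) : continuous g -> {within A, continuous w} ->
  {within A, continuous (fun x => g (w x))}.
Proof.
by move=> cg cw x; exact: (@continuous_comp _ _ _ _ _ x (cw x) (cg (w x))).
Qed.

Lemma within_continuousB (V : normedModType R) (A : set R) (f g : R -> V) :
  {within A, continuous f} -> {within A, continuous g} ->
  {within A, continuous (fun x => f x - g x)}.
Proof.
move=> cf cg x; apply: (@continuousB _ V (subspace A)); first exact: cf.
exact: cg.
Qed.

Lemma within_continuous_sum (J : Type) (r : seq J) (A : set R) (f : J -> R -> R) :
  (forall j, {within A, continuous (f j)}) ->
  {within A, continuous (fun x => \sum_(j <- r) f j x)}.
Proof.
move=> cf; elim: r => [|j r IHr].
  have -> : (fun x => \sum_(j <- [::]) f j x) = cst 0.
    by apply/funext => x; rewrite big_nil.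
  exact: continuous_subspaceT (fun=> @cst_continuous _ _ _ _).
have -> : (fun x => \sum_(j <- j :: r) f j x) =
    (fun x => f j x + \sum_(j <- r) f j x).
  by apply/funext => x; rewrite big_cons.
by move=> x; apply: (@continuousD _ R (subspace A)); [exact: cf|exact: IHr].
Qed.

Lemma within_continuousM (A : set R) (f g : R -> R) :
  {within A, continuous f} -> {within A, continuous g} ->
  {within A, continuous (fun x => f x * g x)}.
Proof.
by move=> cf cg x; apply: (@continuousM _ (subspace A)); [exact: cf|exact: cg].
Qed.

Lemma increment_le (g dg : R -> R) (a b K : R) : a <= b ->
  {within `[a, b], continuous g} ->
  (forall x, a < x < b -> is_derive x 1 g (dg x)) ->
  (forall x, a < x < b -> `|dg x| <= K) ->
  `|g b - g a| <= K * (b - a).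
Proof.
rewrite le_eqVlt => /predU1P[<- *|ab cg Dg Kg]; first by rewrite !subrr mulr0 normr0.
have Dg' x : x \in `]a, b[ -> is_derive x 1 g (dg x).
  by rewrite in_itv; exact: Dg.
have [z zab ->] := MVT ab Dg' cg.
rewrite normrM [`|b - a|]gtr0_norm ?subr_gt0 //.
apply: ler_wpM2r; first by rewrite subr_ge0 ltW.
by apply: Kg; move: zab; rewrite in_itv.
Qed.

End MeanValue.

(** * Families of functions with Taylor-like dependence on the step size *)

Section Families.
Variables (R : realType) (I : Type) (h : I -> R).
Hypothesis h01 : forall a, 0 < h a <= 1.
Implicit Types (p q i l n : nat) (F G : I -> R -> R) (T U : I -> {poly R}).

(** Uniformity of constants over all steps of all grids is expressed once and
    for all by families: [I] indexes the steps, [h a] is the size of step [a],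
    and the one constant C serves the whole family. *)
Definition isO (w : I -> R) F := exists C : R, forall a x, 0 <= x <= 1 ->
  `|F a x| <= C * w a.

Definition bigO p := isO (fun a => h a ^+ p).

(** The coefficient of degree l is O(h^l), as for a Taylor polynomial of
    a smooth function of the unscaled time x h; the parameter i asks for an
    overall factor O(h^i) in addition. The bound on the size makes values at
    points of [0, 1] controllable by the coefficients. *)
Definition hpoly i T := exists n, exists C : R, forall a,
  (size (T a) <= n)%N /\ forall l, `|(T a)`_l| <= C * h a ^+ maxn i l.

(** What remains of being p times differentiable in the unscaled time with
    derivatives bounded uniformly in the step. Working with this class avoids
    higher derivatives of composite functions. *)
Definition taylor p F := exists2 T, hpoly 0 T &
  bigO p (fun a x => F a x - (T a).[x]).

Lemma h_ge0 a : 0 <= h a.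
Proof. by have /andP[/ltW] := h01 a. Qed.

Lemma h_le1 a : h a <= 1.
Proof. by have /andP[] := h01 a. Qed.

Lemma hX_ge0 a p : 0 <= h a ^+ p.
Proof. exact/exprn_ge0/h_ge0. Qed.

Lemma hX_le a p q : (p <= q)%N -> h a ^+ q <= h a ^+ p.
Proof. by move=> pq; rewrite ler_wiXn2l ?h_ge0 ?h_le1. Qed.

Hint Resolve h_ge0 h_le1 hX_ge0 : core.

Section Weights.
Implicit Types w : I -> R.

Lemma isO_ge0 w F : (forall a, 0 <= w a) -> isO w F -> exists2 C : R, 0 <= C &
  forall a x, 0 <= x <= 1 -> `|F a x| <= C * w a.
Proof.
move=> w0 [C FC]; exists `|C| => // a x x01.
by rewrite (le_trans (FC a x x01)) // ler_wpM2r // ler_norm.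
Qed.

Lemma isO_ext w F G : (forall a x, 0 <= x <= 1 -> F a x = G a x) ->
  isO w F -> isO w G.
Proof. by move=> FG [C FC]; exists C => a x x01; rewrite -FG ?FC. Qed.

Lemma isO_le w w' (K : R) F : (forall a, 0 <= w a <= K * w' a) ->
  isO w F -> isO w' F.
Proof.
move=> ww' /isO_ge0[a|C C0 FC]; first by have /andP[] := ww' a.
exists (C * K) => a x x01; rewrite (le_trans (FC a x x01)) // -mulrA.
by rewrite ler_wpM2l //; have /andP[] := ww' a.
Qed.

Lemma isOD w F G : isO w F -> isO w G -> isO w (fun a x => F a x + G a x).
Proof.
case=> [C FC] [D GD]; exists (C + D) => a x x01.
by rewrite mulrDl (le_trans (ler_normD _ _)) // lerD ?FC ?GD.
Qed.

Lemma isON w F : isO w F -> isO w (fun a x => - F a x).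
Proof. by case=> [C FC]; exists C => a x x01; rewrite normrN FC. Qed.

Lemma isOB w F G : isO w F -> isO w G -> isO w (fun a x => F a x - G a x).
Proof. by move=> FO GO; apply: isOD => //; exact: isON. Qed.

Lemma isOM w w' F G : isO w F -> isO w' G ->
  isO (fun a => w a * w' a) (fun a x => F a x * G a x).
Proof.
move=> [C FC] [D GD]; exists (C * D) => a x x01.
by rewrite normrM mulrACA ler_pM ?FC ?GD.
Qed.

Lemma isO0 w : isO w (fun _ _ => 0).
Proof. by exists 0 => a x _; rewrite normr0 mul0r. Qed.

Lemma isO_sum w (J : Type) (r : seq J) (Q : pred J) (F : J -> I -> R -> R) :
  (forall j, Q j -> isO w (F j)) ->
  isO w (fun a x => \sum_(j <- r | Q j) F j a x).
Proof.
move=> FO; elim: r => [|j r IHr].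
  by apply: isO_ext (isO0 w) => a x _; rewrite big_nil.
have [Qj|nQj] := boolP (Q j).
  by apply: isO_ext (isOD (FO j Qj) IHr) => a x _; rewrite big_cons Qj.
by apply: isO_ext IHr => a x _; rewrite big_cons (negPf nQj).
Qed.

Lemma isO_at w F x : 0 <= x <= 1 -> isO w F -> isO w (fun a _ => F a x).
Proof. by move=> x01 [C FC]; exists C => a _ _; exact: FC. Qed.

End Weights.

Lemma bigO_ge0 p F : bigO p F -> exists2 C : R, 0 <= C &
  forall a x, 0 <= x <= 1 -> `|F a x| <= C * h a ^+ p.
Proof. exact: isO_ge0. Qed.

Lemma bigO_le p q F : (p <= q)%N -> bigO q F -> bigO p F.
Proof. by move=> pq; apply: (@isO_le _ _ 1) => a; rewrite mul1r hX_le // hX_ge0. Qed.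

Lemma bigOM p q F G : bigO p F -> bigO q G ->
  bigO (p + q) (fun a x => F a x * G a x).
Proof.
move=> FO /(isOM FO); apply: (@isO_le _ _ 1) => a.
by rewrite -exprD mul1r lexx hX_ge0.
Qed.

Lemma bigO_cst (c : R) : bigO 0 (fun _ _ => c).
Proof. by exists `|c| => a x _; rewrite mulr1. Qed.

Lemma bigO_horner (p : {poly R}) : bigO 0 (fun _ x => p.[x]).
Proof.
exists (\sum_(l < size p) `|p`_l|) => a x /andP[x0 x1]; rewrite mulr1 horner_coef.
rewrite (le_trans (ler_norm_sum _ _ _)) //; apply: ler_sum => l _.
by rewrite normrM ler_piMr // normrX ger0_norm // exprn_ile1.
Qed.

Lemma bigO_h p : bigO p (fun a _ => h a ^+ p).
Proof. by exists 1 => a x _; rewrite mul1r ger0_norm. Qed.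

Lemma hpoly_ge0 i T : hpoly i T -> exists n, exists2 C : R, 0 <= C & forall a,
  (size (T a) <= n)%N /\ forall l, `|(T a)`_l| <= C * h a ^+ maxn i l.
Proof.
case=> n [C TC]; exists n, `|C| => // a; split=> [|l]; first exact: (TC a).1.
by rewrite (le_trans ((TC a).2 l)) // ler_wpM2r // ler_norm.
Qed.

Lemma hpoly_le i j T : (i <= j)%N -> hpoly j T -> hpoly i T.
Proof.
move=> ij /hpoly_ge0[n [C C0 TC]]; exists n, C => a.
split=> [|l]; first exact: (TC a).1.
apply: le_trans ((TC a).2 l) _; rewrite ler_wpM2l // hX_le //.
by rewrite geq_max leq_maxr leq_max ij.
Qed.

Lemma hpoly_ext i T U : (forall a, T a = U a) -> hpoly i T -> hpoly i U.
Proof. by move=> TU [n [C TC]]; exists n, C => a; rewrite -TU; exact: TC. Qed.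

Lemma hpolyD i T U : hpoly i T -> hpoly i U -> hpoly i (fun a => T a + U a).
Proof.
case=> [n [C TC]] [m [D UD]]; exists (maxn n m), (C + D) => a; split=> [|l].
  rewrite (leq_trans (size_polyD _ _)) // geq_max !leq_max.
  by rewrite (TC a).1 (UD a).1 orbT.
by rewrite coefD mulrDl (le_trans (ler_normD _ _)) // lerD ?(TC a).2 ?(UD a).2.
Qed.

Lemma hpoly0 i : hpoly i (fun _ => 0).
Proof.
by exists 0%N, 0 => a; rewrite size_poly0; split=> // l; rewrite coef0 normr0 mul0r.
Qed.

Lemma hpoly_sum i (J : Type) (r : seq J) (Q : pred J) (T : J -> I -> {poly R}) :
  (forall j, Q j -> hpoly i (T j)) ->
  hpoly i (fun a => \sum_(j <- r | Q j) T j a).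
Proof.
move=> TO; elim: r => [|j r IHr].
  by apply: hpoly_ext (hpoly0 i) => a; rewrite big_nil.
have [Qj|nQj] := boolP (Q j).
  by apply: hpoly_ext (hpolyD (TO j Qj) IHr) => a; rewrite big_cons Qj.
by apply: hpoly_ext IHr => a; rewrite big_cons (negPf nQj).
Qed.

Lemma hpolyM i T U : hpoly i T -> hpoly 0 U -> hpoly i (fun a => T a * U a).
Proof.
move=> /hpoly_ge0[n [C C0 TC]] /hpoly_ge0[m [D D0 UD]].
exists (n + m)%N, ((n + m)%:R * (C * D)) => a.
have sTU : (size (T a * U a)%R <= n + m)%N.
  rewrite (leq_trans (size_polyMleq _ _)) // (leq_trans (leq_pred _)) //.
  by rewrite leq_add ?(TC a).1 ?(UD a).1.
split=> // l; have [sl|ls] := leqP (size (T a * U a)%R) l.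
  by rewrite nth_default // normr0 !mulr_ge0 ?ler0n.
rewrite coefM (le_trans (ler_norm_sum _ _ _)) //.
apply: (@le_trans _ _ (\sum_(j < l.+1) C * D * h a ^+ maxn i l)).
  apply: ler_sum => j _; rewrite normrM.
  apply: (@le_trans _ _ (C * h a ^+ maxn i j * (D * h a ^+ (l - j)))).
    by rewrite ler_pM // ?(TC a).2 // (le_trans ((UD a).2 _)) // max0n.
  rewrite mulrACA -exprD ler_wpM2l ?mulr_ge0 // hX_le //.
  rewrite geq_max; apply/andP; split.
    by rewrite (leq_trans (leq_maxl i j)) ?leq_addr.
  have jl : (j <= l)%N by rewrite -ltnS.
  by rewrite -[X in (X <= _)%N](subnKC jl) leq_add2r leq_maxr.
rewrite sumr_const card_ord -[leLHS]mulr_natl mulrA ler_wpM2r //.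
by rewrite ler_wpM2r ?mulr_ge0 // ler_nat (leq_trans ls).
Qed.

Lemma hpolyC i (c : I -> R) : bigO i (fun a _ => c a) ->
  hpoly i (fun a => (c a)%:P).
Proof.
move=> /bigO_ge0[C C0 cC]; exists 1%N, C => a; split=> [|[|l]].
- exact: size_polyC_leq1.
- by rewrite coefC maxn0 (cC a 0) // lexx ler01.
- by rewrite coefC normr0 mulr_ge0.
Qed.

Lemma hpolyZ i (c : R) T : hpoly i T -> hpoly i (fun a => c *: T a).
Proof.
move=> TO; apply: hpoly_ext (hpolyM TO (hpolyC (bigO_cst c))) => a.
by rewrite mulrC mul_polyC.
Qed.

Lemma hpolyN i T : hpoly i T -> hpoly i (fun a => - T a).
Proof.
by move=> TO; apply: hpoly_ext (hpolyZ (-1) TO) => a; rewrite scaleN1r.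
Qed.

Lemma hpolyB i T U : hpoly i T -> hpoly i U -> hpoly i (fun a => T a - U a).
Proof. by move=> TO UO; apply: hpolyD => //; exact: hpolyN. Qed.

Lemma hpoly_scale_small i (c : I -> R) (p : {poly R}) :
  bigO (maxn i (size p).-1) (fun a _ => c a) -> hpoly i (fun a => c a *: p).
Proof.
move=> /bigO_ge0[C C0 cC]; exists (size p).
exists (C * \sum_(j < size p) `|p`_j|) => a; split=> [|l].
  exact: size_scale_leq.
rewrite coefZ normrM; have [sl|ls] := leqP (size p) l.
  by rewrite (nth_default _ sl) normr0 mulr0 !mulr_ge0 // sumr_ge0.
rewrite mulrAC ler_pM //; last first.
  by rewrite (bigD1 (Ordinal ls)) //= lerDl sumr_ge0.
rewrite (le_trans (cC a 0 _)) ?lexx ?ler01 // ler_wpM2l // hX_le //.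
rewrite geq_max leq_maxl /= leq_max; apply/orP; right.
by rewrite -ltnS (leq_trans ls) // leqSpred.
Qed.

Lemma hpoly_bigO i T : hpoly i T -> bigO i (fun a x => (T a).[x]).
Proof.
move=> /hpoly_ge0[n [C C0 TC]]; exists (n%:R * C) => a x /andP[x0 x1].
rewrite (horner_coef_wide x (TC a).1) (le_trans (ler_norm_sum _ _ _)) //.
apply: (@le_trans _ _ (\sum_(j < n) C * h a ^+ i)).
  apply: ler_sum => j _; rewrite normrM -[leRHS]mulr1 ler_pM //.
    rewrite (le_trans ((TC a).2 j)) // ler_wpM2l // hX_le //.
    by rewrite leq_maxl.
  by rewrite normrX ger0_norm // exprn_ile1.
by rewrite sumr_const card_ord -[leLHS]mulr_natl mulrA.
Qed.

(** Integrating raises degrees by one, and the factor h pays for it. *)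
Lemma hpoly_hprim i T : hpoly i T -> hpoly i.+1 (fun a => h a *: prim (T a)).
Proof.
move=> /hpoly_ge0[n [C C0 TC]]; exists n.+1, C => a; split=> [|[|l]].
- rewrite (leq_trans (size_scale_leq _ _)) // (leq_trans (size_prim _)) //.
  by rewrite ltnS (TC a).1.
- by rewrite coefZ coef_prim invr0 !mulr0 normr0 mulr_ge0.
- rewrite coefZ coef_prim /= maxnSS exprS [leRHS]mulrCA normrM (ger0_norm (h_ge0 a)).
  rewrite ler_wpM2l // normrM -[leRHS]mulr1 ler_pM ?(TC a).2 //.
  by rewrite ger0_norm ?invr_ge0 ?ler0n // invf_le1 ?ltr0n // ler1n.
Qed.

(** The antiderivative vanishing at 1 instead of 0, as needed for equations
    that are solved backwards from the end of the step. *)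
Lemma hpoly_adjoint_prim i T : hpoly i T ->
  hpoly i.+1 (fun a => h a *: (prim (T a) - ((prim (T a)).[1])%:P)).
Proof.
move=> TO; have hT := hpoly_hprim TO.
have hT1 : bigO i.+1 (fun a _ => (h a *: prim (T a)).[1]).
  have [C C0 hC] := bigO_ge0 (hpoly_bigO hT).
  by exists C => a x _; apply: hC; rewrite ler01 lexx.
apply: hpoly_ext (hpolyB hT (hpolyC hT1)) => a.
by rewrite scalerBr hornerZ polyCM mul_polyC.
Qed.

Lemma hpoly_coef i T l : hpoly i T -> bigO (maxn i l) (fun a _ => (T a)`_l).
Proof. by case=> n [C TC]; exists C => a x _; exact: (TC a).2. Qed.

Lemma hpoly_coef0 T l : hpoly 0 T -> bigO l (fun a _ => (T a)`_l).
Proof. by move=> /(hpoly_coef l); rewrite max0n. Qed.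

Lemma hpoly_expand i T : hpoly i T ->
  exists n, forall a, T a = \sum_(l < n) (T a)`_l *: 'X^l.
Proof.
case=> n [C TC]; exists n => a; rewrite -poly_def.
by apply/polyP => l; rewrite coef_poly; case: ltnP => // nl;
   rewrite nth_default // (leq_trans (TC a).1).
Qed.

Lemma taylor_ext p F G : (forall a x, 0 <= x <= 1 -> F a x = G a x) ->
  taylor p F -> taylor p G.
Proof.
move=> FG [T TO FT]; exists T => //; apply: isO_ext FT => a x x01.
by rewrite FG.
Qed.

Lemma taylor_le p q F : (p <= q)%N -> taylor q F -> taylor p F.
Proof. by move=> pq [T TO FT]; exists T => //; apply: bigO_le FT. Qed.

Lemma bigO_taylor p F : bigO p F -> taylor p F.
Proof.
move=> FO; exists (fun=> 0); first exact: hpoly0.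
by apply: isO_ext FO => a x _; rewrite horner0 subr0.
Qed.

Lemma hpoly_taylor p T : hpoly 0 T -> taylor p (fun a x => (T a).[x]).
Proof.
move=> TO; exists T => //.
by apply: isO_ext (isO0 _) => a x _; rewrite subrr.
Qed.

Lemma taylor_bigO p F : taylor p F -> bigO 0 F.
Proof.
case=> T TO FT; apply: isO_ext (isOD (bigO_le (leq0n p) FT) (hpoly_bigO TO)).
by move=> a x _; rewrite subrK.
Qed.

Lemma taylorD p F G : taylor p F -> taylor p G -> taylor p (fun a x => F a x + G a x).
Proof.
case=> [T TO FT] [U UO GU]; exists (fun a => T a + U a); first exact: hpolyD.
apply: isO_ext (isOD FT GU) => a x _; rewrite hornerD; ring.
Qed.

Lemma taylorM p F G : taylor p F -> taylor p G -> taylor p (fun a x => F a x * G a x).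
Proof.
move=> FO GO; have GO0 := taylor_bigO GO.
case: FO GO => [T TO FT] [U UO GU]; exists (fun a => T a * U a).
  exact: hpolyM.
have FG := bigOM FT GO0; have TG := bigOM (hpoly_bigO TO) GU.
rewrite addn0 in FG; rewrite add0n in TG.
apply: isO_ext (isOD FG TG) => a x _; rewrite hornerM; ring.
Qed.

Lemma taylor_sum p (J : Type) (r : seq J) (Q : pred J) (F : J -> I -> R -> R) :
  (forall j, Q j -> taylor p (F j)) ->
  taylor p (fun a x => \sum_(j <- r | Q j) F j a x).
Proof.
move=> FO; elim: r => [|j r IHr].
  by apply: taylor_ext (bigO_taylor (isO0 _)) => a x _; rewrite big_nil.
have [Qj|nQj] := boolP (Q j).
  by apply: taylor_ext (taylorD (FO j Qj) IHr) => a x _; rewrite big_cons Qj.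
by apply: taylor_ext IHr => a x _; rewrite big_cons (negPf nQj).
Qed.

(** Integrating an expansion of F'/h gains one order. This is the only source
    of regularity: it replaces Taylor's formula for higher derivatives. *)
Lemma taylor_deriv p F G : bigO 0 (fun a _ => F a 0) ->
  (forall a, {within `[0, 1], continuous (F a)}) ->
  (forall a (x : R), 0 < x < 1 -> is_derive x 1 (F a) (h a * G a x)) ->
  taylor p G -> taylor p.+1 F.
Proof.
move=> F0 cF DF [T TO /bigO_ge0[C C0 GT]].
exists (fun a => (F a 0)%:P + h a *: prim (T a)).
  apply: hpolyD; first exact: hpolyC.
  exact: hpoly_le (hpoly_hprim TO).
exists C => a x /andP[x0 x1].
pose g y := F a y - (h a *: prim (T a)).[y].
have -> : F a x - ((F a 0)%:P + h a *: prim (T a)).[x] = g x - g 0.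
  rewrite /g !hornerE prim_horner0; ring.
apply: (@le_trans _ _ (C * h a ^+ p.+1 * (x - 0))); last first.
  by rewrite subr0 ler_piMr // mulr_ge0.
apply: (@increment_le _ _ (fun y => h a * (G a y - (T a).[y]))) => //.
- have c1 : {within `[0, x], continuous (F a)}.
    apply: continuous_subspaceW (cF a) => y /=.
    by rewrite !in_itv /= => /andP[-> /le_trans]; apply.
  apply: within_continuousB c1 _.
  by apply: continuous_subspaceT => z; exact: continuous_horner.
- move=> y /andP[y0 yx].
  have := DF a y; rewrite y0 (lt_le_trans yx x1) => /(_ isT) DFy.
  have DT := is_derive_poly (h a *: prim (T a)) y.
  rewrite mulrBr -hornerZ -[in X in _ - X](deriv_prim (T a)) -derivZ.
  exact: is_deriveB.
- move=> y /andP[y0 yx]; rewrite normrM ger0_norm // exprS mulrCA ler_wpM2l //.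
  by apply: GT; rewrite (ltW y0) (ltW (lt_le_trans yx x1)).
Qed.

End Families.

(** * Legendre expansion and quadrature *)

Section Legendre.
Variable R : realType.
Implicit Types p : {poly R}.

Definition int01 p : R := (prim p).[1].

Lemma int01_is_linear : linear_for *%R int01.
Proof. by move=> a p q; rewrite /int01 linearP hornerD hornerZ. Qed.
HB.instance Definition _ :=
  GRing.isLinear.Build R {poly R} R _ int01 int01_is_linear.

Lemma int01Z a p : int01 (a *: p) = a * int01 p.
Proof. exact: linearZ. Qed.

Definition quad k (c b : 'I_k -> R) p : R := \sum_(i < k) b i * p.[c i].

Lemma quad_is_linear k (c b : 'I_k -> R) : linear_for *%R (quad c b).
Proof.
move=> a p q; rewrite /quad big_distrr -big_split; apply: eq_bigr => i _ /=.
by rewrite hornerD hornerZ mulrDr mulrCA.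
Qed.
HB.instance Definition _ k (c b : 'I_k -> R) :=
  GRing.isLinear.Build R {poly R} R _ (quad c b) (@quad_is_linear k c b).

Variable P : nat -> {poly R}.
Hypothesis HP : legendre_basis P.

Lemma int01_legendreM i j : int01 (P i * P j) = (i == j)%:R.
Proof. by rewrite -(legendre_orthonormal HP) integral_polyE. Qed.

(** P_j has degree exactly j, so dividing by leading coefficients reduces the
    degree. *)
Lemma legendre_span n p : (size p <= n)%N ->
  exists a : nat -> R, p = \sum_(j < n) a j *: P j.
Proof.
elim: n p => [|n IHn] p sp.
  by exists (fun=> 0); rewrite big_ord0; apply/eqP; rewrite -size_poly_leq0.
have Pn : (P n)`_n != 0.
  by have := lead_coef_eq0 (P n); rewrite lead_coefE -size_poly_eq0
    (legendre_size HP) /= => ->.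
have [|a pa] := IHn (p - (p`_n / (P n)`_n) *: P n).
  apply/leq_sizeP => j; rewrite leq_eqVlt => /predU1P[<-|nj].
    by rewrite coefB coefZ divfK // subrr.
  rewrite coefB coefZ (nth_default _ (leq_trans sp nj)).
  by rewrite (@nth_default _ _ _ j) ?(legendre_size HP) // mulr0 subr0.
exists (fun j => if j == n then p`_n / (P n)`_n else a j).
rewrite big_ord_recr /= eqxx -[LHS](subrK ((p`_n / (P n)`_n) *: P n)) pa.
by congr (_ + _); apply: eq_bigr => j _; rewrite (ltn_eqF (ltn_ord j)).
Qed.

Lemma legendre_expansion n p : (size p <= n)%N ->
  p = \sum_(j < n) int01 (p * P j) *: P j.
Proof.
move=> /legendre_span[a ->]; apply: eq_bigr => j _; congr (_ *: _).
rewrite mulr_suml linear_sum (bigD1 j) //= -scalerAl linearZ /= int01_legendreM.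
rewrite eqxx mulr1 big1 ?addr0 // => i ij.
rewrite -scalerAl linearZ /= int01_legendreM [(i : nat) == j]val_eqE.
by rewrite (negPf ij) mulr0.
Qed.

Lemma legendre_orthogonal_lower j p : (size p <= j)%N -> int01 (P j * p) = 0.
Proof.
move=> /legendre_expansion->; rewrite mulr_sumr linear_sum big1 // => i _.
rewrite -scalerAr linearZ /= int01_legendreM.
by rewrite (gtn_eqF (ltn_ord i)) mulr0.
Qed.

Variables (s k q : nat) (c b : 'I_k -> R).
Hypotheses (Hord : quadrature_order c b q) (Hq : (2 * s <= q)%N).

Lemma quad_exact p : (size p <= 2 * s)%N -> quad c b p = int01 p.
Proof.
by move=> sp; rewrite [LHS]Hord ?integral_polyE // (leq_trans sp).
Qed.

Lemma quad_legendreXn j i : (j + i < 2 * s)%N ->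
  quad c b (P j * 'X^i) = int01 (P j * 'X^i).
Proof.
move=> ji; apply: quad_exact; rewrite (leq_trans (size_polyMleq _ _)) //.
by rewrite size_polyXn (legendre_size HP) addSn addnS.
Qed.

Lemma quad_legendre_lower j i : (j < s)%N -> (i < j)%N ->
  quad c b (P j * 'X^i) = 0.
Proof.
move=> js ij; rewrite quad_legendreXn; last by lia.
by rewrite legendre_orthogonal_lower // size_polyXn.
Qed.

Lemma quad_expansion i : (i < s)%N ->
  'X^i = \sum_(j < s) quad c b (P j * 'X^i) *: P j.
Proof.
move=> ls; rewrite [LHS](@legendre_expansion s); last by rewrite size_polyXn.
apply: eq_bigr => j _; rewrite quad_legendreXn; last by have := ltn_ord j; lia.
by rewrite mulrC.
Qed.

(** The key algebraic identity. One of l, i is less than s. If l < s, then x^l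
    is its own Legendre expansion with terms j <= l, for which P_j x^i has
    degree at most l + i < 2 s, where the quadrature is exact. If i < s, then
    x^i is its own discretized expansion. *)
Lemma quad_moments l i : (l + i < 2 * s)%N ->
  int01 'X^(l + i) =
    \sum_(j < s) int01 ('X^l * P j) * quad c b (P j * 'X^i).
Proof.
move=> li; have [ls|sl] := ltnP l s.
  rewrite exprD {1}[X in X * _](@legendre_expansion s); last first.
    by rewrite size_polyXn.
  rewrite mulr_suml linear_sum; apply: eq_bigr => j _.
  rewrite -scalerAl linearZ /=; have [lj|jl] := ltnP l j.
    have -> : int01 ('X^l * P j) = 0.
      by rewrite mulrC legendre_orthogonal_lower // size_polyXn.
    by rewrite !mul0r.
  by rewrite quad_legendreXn //; lia.
rewrite exprD {1}(@quad_expansion i); last by lia.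
rewrite mulr_sumr linear_sum; apply: eq_bigr => j _.
by rewrite -scalerAr linearZ /= mulrC.
Qed.

End Legendre.

(** * Coordinates and the max-norm *)

Section MaxNorm.
Variables (R : realType) (m n : nat).
Implicit Types x : 'M[R]_(m, n).

Lemma le_coord_norm x i j : `|x i j| <= `|x|.
Proof.
rewrite [leRHS]/Num.Def.normr /= mx_normrE.
exact: (le_bigmax _ (fun ij => `|x ij.1 ij.2|) (i, j)).
Qed.

Lemma norm_le_coord x K : 0 <= K -> (forall i j, `|x i j| <= K) -> `|x| <= K.
Proof.
by move=> K0 xK; rewrite [leLHS]/Num.Def.normr /= mx_normrE bigmax_le.
Qed.

End MaxNorm.

(** * Smooth vector fields along curves *)

Section SmoothMaps.
Variables (R : realType) (m : nat).
Implicit Types (f : 'rV[R]_m -> 'rV[R]_m) (w : R -> 'rV[R]_m).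

Lemma is_derive_coord n (w : R -> 'rV[R]_n) (x : R) (l : 'rV[R]_n) k :
  is_derive x 1 w l -> is_derive x 1 (fun z => w z 0 k) (l 0 k).
Proof.
case=> dw <-; apply: DeriveDef; last by rewrite derive_mx // mxE.
by move/derivable_mxP: dw; exact.
Qed.

Lemma is_derive_rV n (w : R -> 'rV[R]_n) (x : R) (l : 'rV[R]_n) :
  (forall k, is_derive x 1 (fun z => w z 0 k) (l 0 k)) -> is_derive x 1 w l.
Proof.
move=> dw; have dwx : derivable w x 1.
  by apply/derivable_mxP => i j; rewrite (ord1 i); case: (dw j).
apply: DeriveDef => //; apply/rowP => k; rewrite derive_mx // mxE.
by case: (dw k).
Qed.

Lemma is_derive_comp_curve (V W : normedModType R) (g : V -> W) (w : R -> V)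
    (x : R) (dw : V) : differentiable g (w x) ->
  is_derive x 1 w dw -> is_derive x 1 (g \o w) ('D_dw g (w x)).
Proof.
move=> dg [/derivable1_diffP dwx Ew].
have dgw : differentiable (g \o w) x by exact: differentiable_comp.
apply: DeriveDef; first exact/derivable1_diffP.
by rewrite deriveE // diff_comp //= -(deriveE _ dwx) Ew deriveE.
Qed.

Lemma derive_sum_delta f a v : differentiable f a ->
  'D_v f a = \sum_i v 0 i *: 'D_(delta_mx 0 i) f a.
Proof.
move=> df; rewrite deriveE // {1}(row_sum_delta v) linear_sum.
by apply: eq_bigr => i _; rewrite linearZ deriveE.
Qed.

Definition partial f (i : 'I_m) a : 'rV[R]_m := 'D_(delta_mx 0 i) f a.

Lemma class_C_differentiable p f : class_C p.+1 f -> forall a, differentiable f a.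
Proof. by case. Qed.

Lemma class_C_partial p f i : class_C p.+1 f -> class_C p (partial f i).
Proof. by case=> _; apply. Qed.

Lemma class_C_continuous p f : class_C p f -> continuous f.
Proof.
by case: p => [//|p] /class_C_differentiable df a; exact: differentiable_continuous.
Qed.

Lemma class_CW p f : class_C p.+1 f -> class_C p f.
Proof.
elim: p f => [|p IHp] f Cf; first exact: class_C_continuous Cf.
by split=> [|v]; [exact: Cf.1 | apply: IHp; exact: Cf.2].
Qed.

Lemma class_C_le p q f : (p <= q)%N -> class_C q f -> class_C p f.
Proof.
move=> /subnK <-; elim: (q - p)%N => [//|d IHd] Cf.
by apply: IHd; exact: class_CW.
Qed.

(** The chain rule in terms of partial derivatives, which are again of class C
    of one order less: the form suited to induction on the order. *)
Lemma is_derive_comp_coord f w (x : R) (dw : 'rV[R]_m) k : differentiable f (w x) ->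
  is_derive x 1 w dw ->
  is_derive x 1 (fun z => f (w z) 0 k)
    (\sum_i dw 0 i * partial f i (w x) 0 k).
Proof.
move=> df Dw; have := is_derive_coord k (is_derive_comp_curve df Dw).
rewrite derive_sum_delta // summxE.
by under eq_bigr do rewrite mxE.
Qed.

Lemma continuous_bounded_ball n (g : 'rV[R]_m -> 'rV[R]_n) B : continuous g ->
  exists2 M, 0 <= M & forall x, `|x| <= B -> `|g x| <= M.
Proof.
move=> cg; have [B0|B0] := leP 0 B; last first.
  by exists 0 => // x xB; have := le_lt_trans xB B0; rewrite ltNge normr_ge0.
have bB : bounded_set [set x : 'rV[R]_m | `|x| <= B].
  exists B; split; first exact: num_real.
  by move=> x Bx y /= yB; apply: le_trans yB (ltW Bx).
have clB : closed [set x : 'rV[R]_m | `|x| <= B].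
  by apply: closed_comp (@closed_le _ B) => x _; exact: norm_continuous.
have [||x _ gx] := @EVT_max_rV R m (fun x => `|g x|) _ _
    (bounded_closed_compact bB clB).
- by exists 0; rewrite /= normr0.
- apply: continuous_subspaceT => x.
  by apply: continuous_comp; [exact: cg | exact: norm_continuous].
- by exists `|g x| => // y yB; apply: gx; rewrite inE.
Qed.

Lemma is_derive_segment (a v : 'rV[R]_m) (x : R) :
  is_derive x 1 (fun z : R => a + z *: v) v.
Proof.
apply: is_derive_rV => k.
have -> : (fun z : R => (a + z *: v) 0 k) = (fun z => a 0 k + z * v 0 k).
  by apply/funext => z; rewrite !mxE.
have : is_derive x 1 (fun z : R => a 0 k + z * v 0 k) (0 + (x *: 0 + v 0 k *: 1)).
  by apply: is_deriveD; apply: is_deriveM.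
by rewrite scaler0 !add0r [_ *: _]mulr1.
Qed.

Lemma ball_segment (a v : 'rV[R]_m) B x : `|a| <= B -> `|a + v| <= B ->
  0 <= x <= 1 -> `|a + x *: v| <= B.
Proof.
move=> aB avB /andP[x0 x1].
have -> : a + x *: v = (1 - x) *: a + x *: (a + v).
  by rewrite scalerBl scale1r scalerDr addrA subrK.
rewrite (le_trans (ler_normD _ _)) // !normrZ ger0_norm ?subr_ge0 // ger0_norm //.
have : (1 - x) * `|a| <= (1 - x) * B by rewrite ler_wpM2l ?subr_ge0.
have : x * `|a + v| <= x * B by rewrite ler_wpM2l.
lra.
Qed.

Lemma continuous_comp_coord f w (A : set R) k : continuous f ->
  {within A, continuous w} -> {within A, continuous (fun z => f (w z) 0 k)}.
Proof.
move=> cf cw; have cfk : continuous (fun y => f y 0 k).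
  move=> y; apply: (@continuous_comp _ _ _ f (fun y => y 0 k)); first exact: cf.
  exact: coord_continuous.
exact: within_continuous_comp cfk cw.
Qed.

(** The segment between two points of a ball stays in the ball, where the
    partial derivatives are bounded. *)
Lemma lipschitz_ball f B : class_C 1 f ->
  exists2 L, 0 <= L & forall x y, `|x| <= B -> `|y| <= B ->
    `|f x - f y| <= L * `|x - y|.
Proof.
move=> Cf; have df := class_C_differentiable Cf.
have /choice[M HM] : forall i, exists M, 0 <= M /\
    forall x, `|x| <= B -> `|partial f i x| <= M.
  move=> i; have [M M0 HM] := continuous_bounded_ball B
    (class_C_continuous (class_C_partial i Cf)).
  by exists M.
have M0 i := (HM i).1; have {}HM i := (HM i).2.
exists (\sum_i M i); first by rewrite sumr_ge0.
move=> x y xB yB; apply: norm_le_coord => [|i k].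
  by rewrite mulr_ge0 // sumr_ge0.
rewrite !mxE ord1.
have := @increment_le R (fun z : R => f (y + z *: (x - y)) 0 k)
  (fun z => \sum_i (x - y) 0 i * partial f i (y + z *: (x - y)) 0 k) 0 1
  ((\sum_i M i) * `|x - y|) ler01.
rewrite scale1r scale0r addr0 [y + _]addrC subrK subr0 mulr1; apply.
- apply: continuous_comp_coord; first exact: class_C_continuous Cf.
  apply: continuous_subspaceT => z; apply: differentiable_continuous.
  by apply/derivable1_diffP; case: (is_derive_segment y (x - y) z).
- by move=> z _; apply: is_derive_comp_coord => //; exact: is_derive_segment.
- move=> z /andP[z0 z1]; rewrite (le_trans (ler_norm_sum _ _ _)) //.
  rewrite mulr_suml ler_sum // => j _; rewrite normrM mulrC.
  rewrite ler_pM ?le_coord_norm // (le_trans (le_coord_norm _ _ _)) // HM //.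
  by apply: ball_segment; rewrite ?(ltW z0) ?(ltW z1) // addrC subrK.
Qed.

(** The derivative of z |-> f (a + z v) differs from its value at 0 by a
    combination of increments of the partial derivatives, which are Lipschitz. *)
Lemma taylor2_ball f B : class_C 2 f ->
  exists2 C, 0 <= C & forall a v k, `|a| <= B -> `|a + v| <= B ->
    `|f (a + v) 0 k - f a 0 k - \sum_i v 0 i * partial f i a 0 k|
      <= C * `|v| ^+ 2.
Proof.
move=> Cf; have df := class_C_differentiable Cf.
have /choice[L HL] : forall i, exists L, 0 <= L /\
    forall x y, `|x| <= B -> `|y| <= B ->
      `|partial f i x - partial f i y| <= L * `|x - y|.
  move=> i; have [L L0 HL] := lipschitz_ball B (class_C_partial i Cf).
  by exists L.
have L0 i := (HL i).1; have {}HL i := (HL i).2.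
exists (\sum_i L i); first by rewrite sumr_ge0.
move=> a v k aB avB.
have dl (x : R) : is_derive x 1 (fun z : R => z * \sum_i v 0 i * partial f i a 0 k)
    (\sum_i v 0 i * partial f i a 0 k).
  have : is_derive x 1 (fun z : R => z * \sum_i v 0 i * partial f i a 0 k)
    (x *: 0 + (\sum_i v 0 i * partial f i a 0 k) *: 1) by exact: is_deriveM.
  by rewrite scaler0 add0r [_ *: _]mulr1.
have := @increment_le R (fun z : R => f (a + z *: v) 0 k -
     z * \sum_i v 0 i * partial f i a 0 k)
  (fun z => \sum_i v 0 i * partial f i (a + z *: v) 0 k -
     \sum_i v 0 i * partial f i a 0 k) 0 1
  ((\sum_i L i) * `|v| ^+ 2) ler01.
rewrite scale1r scale0r subr0 mulr1 addr0 mul1r mul0r subr0.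
rewrite -addrA [- _ - _]addrC addrA; apply.
- have c1 : {within `[0, 1], continuous (fun z : R => f (a + z *: v) 0 k)}.
    apply: continuous_comp_coord; first exact: class_C_continuous Cf.
    apply: continuous_subspaceT => z; apply: differentiable_continuous.
    by apply/derivable1_diffP; case: (is_derive_segment a v z).
  have c2 : {within `[0, 1], continuous
      (fun z : R => z * \sum_i v 0 i * partial f i a 0 k)}.
    apply: continuous_subspaceT => z; apply: differentiable_continuous.
    by apply/derivable1_diffP; case: (dl z).
  exact: within_continuousB c1 c2.
- move=> z _; apply: is_deriveB.
  by apply: is_derive_comp_coord => //; exact: is_derive_segment.
- move=> z /andP[z0 z1]; rewrite -sumrB (le_trans (ler_norm_sum _ _ _)) //.
  rewrite mulr_suml ler_sum // => j _; rewrite -mulrBr normrM expr2 mulrCA.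
  rewrite ler_pM ?le_coord_norm //.
  have -> : partial f j (a + z *: v) 0 k - partial f j a 0 k =
    (partial f j (a + z *: v) - partial f j a) 0 k by rewrite !mxE.
  rewrite (le_trans (le_coord_norm _ _ _)) // (le_trans (HL _ _ _ _ aB)) //.
    by apply: ball_segment; rewrite ?(ltW z0) ?(ltW z1).
  rewrite ler_wpM2l // addrC addKr normrZ ger0_norm ?(ltW z0) //.
  by rewrite ler_piMl // ltW.
Qed.

Variables (I : Type) (h : I -> R).
Hypothesis h01 : forall a, 0 < h a <= 1.
Variables (B : R) (v dv : I -> R -> 'rV[R]_m).
Hypothesis vB : forall a x, 0 <= x <= 1 -> `|v a x| <= B.

Lemma comp_bigO0 f : continuous f ->
  forall k, bigO h 0 (fun a x => f (v a x) 0 k).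
Proof.
move=> cf k; have [M M0 HM] := continuous_bounded_ball B cf.
exists M => a x x01; rewrite mulr1 (le_trans (le_coord_norm _ _ _)) //.
by apply: HM; exact: vB.
Qed.

Hypothesis Dv : forall a (x : R), is_derive x 1 (v a) (h a *: dv a x).

(** Induction on the order: the derivative of f along v is a sum of products
    of components of v'/h and of partial derivatives of f along v. *)
Lemma taylor_comp p f : class_C p f ->
  (forall i, taylor h p.-1 (fun a x => dv a x 0 i)) ->
  forall k, taylor h p (fun a x => f (v a x) 0 k).
Proof.
elim: p f => [|p IHp] f Cf dvO k; first exact/bigO_taylor/comp_bigO0.
have cf := class_C_continuous Cf.
apply: (@taylor_deriv _ _ h h01 p _
  (fun a x => \sum_i dv a x 0 i * partial f i (v a x) 0 k)).
- have [C C0 HC] := bigO_ge0 h01 (comp_bigO0 cf k).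
  by exists C => a x _; apply: HC; rewrite lexx ler01.
- move=> a; apply: continuous_comp_coord => //.
  apply: continuous_subspaceT => z; apply: differentiable_continuous.
  by apply/derivable1_diffP; case: (Dv a z).
- move=> a x _; rewrite mulr_sumr.
  have := is_derive_comp_coord k (class_C_differentiable Cf (v a x)) (Dv a x).
  by under [X in is_derive _ _ _ X -> _]eq_bigr do rewrite mxE -mulrA.
- apply: taylor_sum => // i _; apply: (taylorM h01 (dvO i)).
  apply: IHp => [|j]; first exact: class_C_partial.
  by apply: taylor_le (dvO j) => //; exact: leq_pred.
Qed.

End SmoothMaps.

(** * Defect of the discretized Legendre projection *)

Section Residual.
Variables (R : realType) (P : nat -> {poly R}) (s k q : nat) (c b : 'I_k -> R).
Hypotheses (HP : legendre_basis P) (Hord : quadrature_order c b q).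
Hypothesis (Hq : (2 * s <= q)%N).

(** For a polynomial p in place of f along the discrete solution, this is the
    defect f - sum_j P_j gamma_j left by the truncated expansion with
    quadrature coefficients. *)
Definition residual (p : {poly R}) : {poly R} :=
  p - \sum_(j < s) quad c b (P j * p) *: P j.

Lemma residual_is_linear : linear residual.
Proof.
move=> a p p'; rewrite /residual.
have -> : \sum_(j < s) quad c b (P j * (a *: p + p')) *: P j =
    a *: \sum_(j < s) quad c b (P j * p) *: P j +
    \sum_(j < s) quad c b (P j * p') *: P j.
  rewrite scaler_sumr -big_split; apply: eq_bigr => j _ /=.
  by rewrite mulrDr -scalerAr linearP scalerDl scalerA.
by rewrite scalerBr opprD addrACA.
Qed.
HB.instance Definition _ :=
  GRing.isLinear.Build R {poly R} {poly R} _ residual residual_is_linear.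

Lemma residual_lower i : (i < s)%N -> residual 'X^i = 0.
Proof. by move=> ls; rewrite /residual -(quad_expansion HP Hord Hq ls) subrr. Qed.

Lemma int01_residual_lower l i : (l + i < 2 * s)%N ->
  int01 ('X^l * residual 'X^i) = 0.
Proof.
move=> li; rewrite /residual mulrBr -exprD linearB /=.
rewrite (quad_moments HP Hord Hq li) mulr_sumr linear_sum.
apply/eqP; rewrite subr_eq0; apply/eqP; apply: eq_bigr => j _.
by rewrite -scalerAr linearZ /= mulrC.
Qed.

Lemma size_residualXn l : (s <= l)%N -> (size (residual 'X^l) <= l.+1)%N.
Proof.
move=> sl; rewrite (leq_trans (size_polyD _ _)) // size_polyN geq_max.
rewrite size_polyXn leqnn /= (leq_trans (size_sum _ _ _)) //.
apply/bigmax_leqP => j _; rewrite (leq_trans (size_scale_leq _ _)) //.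
by rewrite (legendre_size HP) ltnS (leq_trans (ltnW (ltn_ord j))).
Qed.

Variables (I : Type) (h : I -> R).
Hypothesis h01 : forall a, 0 < h a <= 1.
Implicit Types T W : I -> {poly R}.

Lemma hpoly_residual T : hpoly h 0 T -> hpoly h s (fun a => residual (T a)).
Proof.
move=> TO; have [n Tn] := hpoly_expand TO.
apply: (@hpoly_ext _ _ _ _ (fun a => \sum_(l < n) (T a)`_l *: residual 'X^l)) =>
  [a|].
  rewrite [in RHS]Tn linear_sum; apply: eq_bigr => l _.
  by rewrite linearZ.
apply: hpoly_sum => l _; have [ls|sl] := ltnP l s.
  by rewrite residual_lower //; apply: hpoly_ext (hpoly0 _ _) => a; rewrite scaler0.
apply: hpoly_scale_small => //; apply: bigO_le (hpoly_coef l TO) => //.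
by have := size_residualXn sl; lia.
Qed.

(** A product of coefficients W_l T_i is O(h^(l+i)), and it is multiplied by 0
    as soon as l + i < 2 s. *)
Lemma int01_residual_small W T : hpoly h 0 W -> hpoly h 0 T ->
  bigO h (2 * s) (fun a _ => int01 (W a * residual (T a))).
Proof.
move=> WO TO; have [n Wn] := hpoly_expand WO; have [n' Tn] := hpoly_expand TO.
apply: (@isO_ext _ _ _ (fun a _ => \sum_(l < n) \sum_(i < n')
  (W a)`_l * (T a)`_i * int01 ('X^l * residual 'X^i))) => [a x _|].
  rewrite [in RHS]Wn [in RHS]Tn mulr_suml linear_sum.
  apply: eq_bigr => l _; rewrite linear_sum mulr_sumr linear_sum.
  apply: eq_bigr => i _ /=.
  by rewrite [in RHS]linearZ /= -[in RHS]scalerAr -[in RHS]scalerAl !int01Z mulrCA mulrA.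
apply: isO_sum => l _; apply: isO_sum => i _; have [li|li] := ltnP (l + i)%N (2 * s).
  rewrite int01_residual_lower //.
  by apply: isO_ext (isO0 _) => a x _; rewrite mulr0.
apply: (@bigO_le _ _ _ h01 _ _ _ li); rewrite -[(l + i)%N]addn0.
apply: (bigOM h01); last exact: bigO_cst.
by apply: (bigOM h01); [exact: hpoly_coef0|exact: hpoly_coef0].
Qed.

Hypothesis c01 : forall i, 0 <= c i <= 1.

Lemma quad_taylor p j (F : I -> R -> R) T :
  bigO h p (fun a x => F a x - (T a).[x]) ->
  bigO h p (fun a _ => \sum_(i < k) b i * (P j).[c i] * F a (c i)
                       - quad c b (P j * T a)).
Proof.
move=> FT.
apply: (@isO_ext _ _ _ (fun a _ => \sum_(i < k)
  b i * (P j).[c i] * (F a (c i) - (T a).[c i]))) => [a x _|].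
  rewrite /quad -sumrB; apply: eq_bigr => i _; rewrite hornerM; ring.
apply: isO_sum => i _; rewrite -[p]add0n; apply: (bigOM h01); first exact: bigO_cst.
by have := isO_at (c01 i) FT.
Qed.

(** P_j is orthogonal to the monomials of degree less than j, also in the
    quadrature, so that only coefficients O(h^l) with l >= j contribute. *)
Lemma quad_hpoly_small j T : (j < s)%N -> hpoly h 0 T ->
  bigO h j (fun a _ => quad c b (P j * T a)).
Proof.
move=> js TO; have [n Tn] := hpoly_expand TO.
apply: (@isO_ext _ _ _ (fun a _ => \sum_(l < n)
  (T a)`_l * quad c b (P j * 'X^l))) => [a x _|].
  rewrite [in RHS]Tn mulr_sumr linear_sum; apply: eq_bigr => l _.
  by rewrite -scalerAr linearZ.
apply: isO_sum => l _; have [lj|jl] := ltnP l j.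
  rewrite (quad_legendre_lower HP Hord Hq js lj).
  by apply: isO_ext (isO0 _) => a x _; rewrite mulr0.
apply: (@bigO_le _ _ _ h01 _ _ _ jl).
have := bigOM h01 (hpoly_coef0 l TO) (bigO_cst h (quad c b (P j * 'X^l))).
by rewrite addn0.
Qed.

Lemma quad_taylor_small p j (F : I -> R -> R) : (j < s)%N -> taylor h p F ->
  bigO h (minn j p) (fun a _ => \sum_(i < k) b i * (P j).[c i] * F a (c i)).
Proof.
move=> js [T TO FT].
have O1 := bigO_le h01 (geq_minl j p) (quad_hpoly_small js TO).
have O2 := bigO_le h01 (geq_minr j p) (quad_taylor j FT).
by apply: isO_ext (isOD O2 O1) => a x _; rewrite subrK.
Qed.

End Residual.

(** * Approximate adjoint solutions *)

Section Adjoint.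
Variables (R : realType) (I : Type) (h : I -> R).
Hypothesis h01 : forall a, 0 < h a <= 1.
Variables (m : nat) (A : 'I_m -> 'I_m -> I -> {poly R}) (k : 'I_m).
Hypothesis AO : forall j i, hpoly h 0 (A j i).

Let picard (Z : 'I_m -> I -> {poly R}) j a : {poly R} :=
  let p := prim (\sum_i Z i a * A j i a) in
  (j == k)%:R%:P - h a *: (p - (p.[1])%:P).

(** Z approximates, up to O(h^(n+1)), the row vector solution of
    Z' = - h Z A with Z(1) the k-th basis vector: it is obtained by n + 1
    Picard iterations, each of which gains a factor h and stays within
    polynomials. *)
Lemma approximate_adjoint n : exists Z : 'I_m -> I -> {poly R},
  [/\ forall i, hpoly h 0 (Z i),
      forall i a, (Z i a).[1] = (i == k)%:R,
      forall i, bigO h 1 (fun a x => (Z i a).[x] - (i == k)%:R)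
    & forall j, bigO h n.+1 (fun a x =>
        (Z j a)^`().[x] + h a * \sum_i (Z i a).[x] * (A j i a).[x])].
Proof.
have sumO l Z : (forall i, hpoly h l (Z i)) -> forall j,
    hpoly h l (fun a => \sum_i Z i a * A j i a).
  by move=> ZO j; apply: hpoly_sum => i _; exact: hpolyM.
have picardO Z : (forall i, hpoly h 0 (Z i)) -> forall j, hpoly h 0 (picard Z j).
  move=> ZO j; apply: hpolyB => //; first exact: (hpolyC h01 (bigO_cst h (j == k)%:R)).
  exact/(hpoly_le h01 _ (hpoly_adjoint_prim h01 (sumO _ _ ZO j))).
have [Z [ZO dZ]] : exists Z, (forall i, hpoly h 0 (Z i)) /\
    forall j, hpoly h n (fun a => picard Z j a - Z j a).
  elim: n => [|n [Z [ZO dZ]]].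
    exists (fun _ _ => 0); split=> [i|j]; first exact: hpoly0.
    by apply: (hpolyB h01); [apply: picardO => i|]; exact: hpoly0.
  (* Another iteration gains one order in the difference picard Z - Z. *)
  exists (picard Z); split=> [|j]; first exact: picardO.
  apply: hpoly_ext (hpolyN h01 (hpoly_adjoint_prim h01 (sumO _ _ dZ j))) => a.
  (* The Picard map is affine: consecutive differences satisfy the linear recursion. *)
  pose Q (U : 'I_m -> I -> {poly R}) := \sum_i U i a * A j i a.
  have picardE U : picard U j a =
    (j == k)%:R%:P - h a *: (prim (Q U) - ((prim (Q U)).[1])%:P) by [].
  have -> : \sum_i (picard Z i a - Z i a) * A j i a = Q (picard Z) - Q Z.
    by rewrite -sumrB; apply: eq_bigr => i _; rewrite mulrBl.
  rewrite !picardE [prim (_ - _)]linearB /= hornerD hornerN polyCB -!mul_polyC /=; ring.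
exists (picard Z); split.
- exact: picardO.
- by move=> i a; rewrite /picard hornerD hornerN hornerZ hornerD hornerN !hornerC
    subrr mulr0 subr0.
- move=> i; apply: isO_ext (isON (hpoly_bigO h01 (hpoly_adjoint_prim h01
    (sumO _ _ ZO i)))) => a x _.
  by rewrite /picard hornerD hornerC hornerN addrAC subrr add0r.
- move=> j; apply: (@isO_ext _ _ _ (fun a x =>
    h a ^+ 1 * (\sum_i (picard Z i a - Z i a) * A j i a).[x])) => [a x _|].
    rewrite expr1 derivD derivC add0r derivN derivZ derivB deriv_prim derivC subr0.
    rewrite hornerN hornerZ addrC -mulrBr; congr (_ * _); rewrite !horner_sum.
    by rewrite -sumrB; apply: eq_bigr => i _; rewrite mulrBl hornerD hornerN !hornerM.
  rewrite -add1n; apply: (bigOM h01); first exact: bigO_h.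
  exact/(hpoly_bigO h01)/sumO.
Qed.

End Adjoint.

(** * Regularity of the discrete solution on one step *)

Section LocalError.
Variables (R : realType) (m : nat) (f : 'rV[R]_m -> 'rV[R]_m).
Variables (P : nat -> {poly R}) (s k q : nat) (c b : 'I_k -> R).
Hypotheses (HP : legendre_basis P) (Hord : quadrature_order c b q).
Hypotheses (Hq : (2 * s <= q)%N) (c01 : forall i, 0 <= c i <= 1).
Hypothesis Cf : class_C (2 * s) f.
Variables (I : Type) (h : I -> R) (B : R) (v : I -> R -> 'rV[R]_m).
Hypothesis h01 : forall a, 0 < h a <= 1.

Let gam a j := \sum_(i < k) (b i * (P j).[c i]) *: f (v a (c i)).
Let dv a x := \sum_(j < s) (P j).[x] *: gam a j.

Hypothesis v_eq : forall a x,
  v a x = v a 0 + h a *: \sum_(j < s) (prim (P j)).[x] *: gam a j.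
Hypothesis vB : forall a x, 0 <= x <= 1 -> `|v a x| <= B.

Lemma is_derive_stage a (x : R) : is_derive x 1 (v a) (h a *: dv a x).
Proof.
apply: is_derive_rV => i.
pose p := (v a 0 0 i)%:P + \sum_(j < s) (h a * gam a j 0 i) *: prim (P j).
have -> : (fun z => v a z 0 i) = horner p.
  apply/funext => z; rewrite v_eq !mxE /p hornerD hornerC horner_sum summxE.
  congr (_ + _); rewrite mulr_sumr; apply: eq_bigr => j _.
  rewrite hornerZ !mxE; ring.
have -> : (h a *: dv a x) 0 i = p^`().[x]; last exact: is_derive_poly.
rewrite /p derivD derivC add0r (linear_sum (@deriv R)) horner_sum !mxE summxE mulr_sumr.
by apply: eq_bigr => j _; rewrite /= derivZ deriv_prim hornerZ !mxE; ring.
Qed.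

Let F i a x := f (v a x) 0 i.

Lemma gam_coord a j i :
  gam a j 0 i = \sum_(l < k) b l * (P j).[c l] * F i a (c l).
Proof. by rewrite summxE; apply: eq_bigr => l _; rewrite mxE. Qed.

Lemma dv_coord a x i : dv a x 0 i = \sum_(j < s) (P j).[x] * gam a j 0 i.
Proof. by rewrite summxE; apply: eq_bigr => j _; rewrite mxE. Qed.

(** The j-th coefficient is O(h^min(j,p)). For j <= p this makes
    gamma_j P_j, of degree j, an admissible polynomial; for j > p the whole
    term is O(h^p). *)
Lemma taylor_slope p : (forall i, taylor h p (F i)) ->
  forall i, taylor h p (fun a x => dv a x 0 i).
Proof.
move=> FO i; apply: (@taylor_ext _ _ _ _
  (fun a x => \sum_(j < s) (gam a j 0 i *: P j).[x])) => [a x _|].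
  by rewrite dv_coord; apply: eq_bigr => j _; rewrite hornerZ mulrC.
apply: taylor_sum => j _.
have gO : bigO h (minn j p) (fun a _ => gam a j 0 i).
  apply: (@isO_ext _ _ _ (fun a _ => \sum_(l < k) b l * (P j).[c l] * F i a (c l))).
    by move=> a x _; rewrite gam_coord.
  exact: (quad_taylor_small HP Hord Hq).
have [jp|pj] := leqP j p.
  apply: hpoly_taylor; apply: hpoly_scale_small => //.
  by rewrite (legendre_size HP) max0n; rewrite (minn_idPl jp) in gO.
apply: bigO_taylor; rewrite (minn_idPr (ltnW pj)) in gO.
have PO := bigO_horner h (P j).
have := bigOM h01 gO PO; rewrite addn0.
by apply: isO_ext => a x _; rewrite hornerZ.
Qed.

(** Bootstrapping: an expansion of f along v to order p gives one of v'/h, and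
    then one of f along v to order p + 1, up to the regularity of f. *)
Lemma taylor_stage p : (p <= 2 * s)%N -> forall i, taylor h p (F i).
Proof.
elim: p => [|p IHp] ps i; first exact/bigO_taylor/(comp_bigO0 _ vB)/class_C_continuous/Cf.
apply: (taylor_comp h01 vB is_derive_stage (class_C_le ps Cf)) => j.
by apply: taylor_slope; apply: IHp; exact: ltnW.
Qed.

Lemma taylor_partial_stage p i j : (p < 2 * s)%N ->
  taylor h p (fun a x => partial f i (v a x) 0 j).
Proof.
move=> ps; apply: (taylor_comp h01 vB is_derive_stage) => [|l].
  by apply: class_C_partial; apply: class_C_le Cf.
apply: taylor_slope => l'; apply: taylor_stage.
by rewrite (leq_trans (leq_pred _)) // ltnW.
Qed.

(** Replacing f along v by its polynomial part changes the coefficients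
    gamma_j by O(h^(2s)) only. *)
Lemma stage_defect i : exists2 T, hpoly h 0 T &
  bigO h (2 * s) (fun a x => F i a x - dv a x 0 i - (residual P s c b (T a)).[x]).
Proof.
have [T TO FT] := taylor_stage (leqnn _) i; exists T => //.
apply: (@isO_ext _ _ _ (fun a x => (F i a x - (T a).[x]) - \sum_(j < s)
   (P j).[x] * (gam a j 0 i - quad c b (P j * T a)))) => [a x _|].
  rewrite /residual hornerD hornerN horner_sum dv_coord.
  under eq_bigr do rewrite mulrBr.
  rewrite sumrB; under [X in _ = _ - (_ - X)]eq_bigr do rewrite hornerZ mulrC.
  ring.
apply: isOB => //; apply: isO_sum => j _; rewrite -[(2 * s)%N]add0n.
apply: (bigOM h01); first exact: (bigO_horner h).
by apply: isO_ext (quad_taylor P b h01 c01 j FT) => a x _; rewrite gam_coord.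
Qed.

End LocalError.

(** * Error propagation over one step *)

Section StepError.
Variables (R : realType) (m : nat) (f : 'rV[R]_m -> 'rV[R]_m).
Variables (P : nat -> {poly R}) (s k q : nat) (c b : 'I_k -> R).
Hypotheses (HP : legendre_basis P) (Hord : quadrature_order c b q).
Hypotheses (Hs : (1 <= s)%N) (Hq : (2 * s <= q)%N).
Hypothesis c01 : forall i, 0 <= c i <= 1.
Hypothesis Cf : class_C (2 * s) f.
Variables (B L : R).
Hypothesis L0 : 0 <= L.
Hypothesis fL : forall x y, `|x| <= B -> `|y| <= B -> `|f x - f y| <= L * `|x - y|.
Variables (I : Type) (h : I -> R) (v u : I -> R -> 'rV[R]_m).
Hypothesis h01 : forall a, 0 < h a <= 1.
Hypothesis hL : forall a, h a * L <= 2^-1.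

Let gam a j := \sum_(i < k) (b i * (P j).[c i]) *: f (v a (c i)).
Let dv a x := \sum_(j < s) (P j).[x] *: gam a j.

Hypothesis v_eq : forall a x,
  v a x = v a 0 + h a *: \sum_(j < s) (prim (P j)).[x] *: gam a j.
Hypothesis vB : forall a x, 0 <= x <= 1 -> `|v a x| <= B.
Hypothesis uB : forall a x, 0 <= x <= 1 -> `|u a x| <= B.
Hypothesis cu : forall a, {within `[0, 1], continuous (u a)}.
Hypothesis Du : forall a (x : R), 0 < x < 1 ->
  is_derive x 1 (u a) (h a *: f (u a x)).

Let e a x := u a x - v a x.
Let d a := `|e a 0|.

Lemma is_derive_error a (x : R) i : 0 < x < 1 -> is_derive x 1
  (fun z => e a z 0 i) (h a * (f (u a x) 0 i - dv a x 0 i)).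
Proof.
move=> x01; have := is_derive_coord i (is_deriveB (Du a x01) (is_derive_stage v_eq a x)).
by rewrite -scalerBr !mxE.
Qed.

Lemma continuous_error a : {within `[0, 1], continuous (e a)}.
Proof.
have cv : {within `[0, 1], continuous (v a)}.
  apply: continuous_subspaceT => z; apply: differentiable_continuous.
  by apply/derivable1_diffP; case: (is_derive_stage v_eq a z).
exact: within_continuousB (@cu a) cv.
Qed.

Lemma continuous_error_coord a i : {within `[0, 1], continuous (fun z => e a z 0 i)}.
Proof.
apply: (within_continuous_comp (g := fun y : 'rV[R]_m => y 0 i)).
  exact: coord_continuous.
exact: continuous_error.
Qed.

Lemma stage_slope_defect : exists2 D : R, 0 <= D & forall a x i, 0 <= x <= 1 ->
  `|f (v a x) 0 i - dv a x 0 i| <= D * h a ^+ s.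
Proof.
have /choice[D HD] : forall i, exists D : R, 0 <= D /\
    forall a x, 0 <= x <= 1 -> `|f (v a x) 0 i - dv a x 0 i| <= D * h a ^+ s.
  move=> i; have [T TO FT] := stage_defect HP Hord Hq c01 Cf h01 v_eq vB i.
  have rO := hpoly_bigO h01 (hpoly_residual HP Hord Hq h01 TO).
  have ss : (s <= 2 * s)%N by lia.
  have [D D0 HD] := bigO_ge0 h01 (isOD (bigO_le h01 ss FT) rO).
  by exists D; split=> // a x x01; have := HD a x x01; rewrite subrK.
exists (\sum_i D i) => [|a x i x01]; first by apply: sumr_ge0 => i _; case: (HD i).
rewrite (le_trans ((HD i).2 a x x01)) // ler_wpM2r ?hX_ge0 //.
by rewrite (bigD1 i) //= lerDl sumr_ge0 // => j _; case: (HD j).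
Qed.

(** The defect is O(h^s), hence the maximum M of |e| satisfies
    M <= |e(0)| + h (L M + C h^s), and h L <= 1/2 absorbs M. *)
Lemma stage_error : isO (fun a => d a + h a ^+ s.+1) (fun a x => `|e a x|).
Proof.
have [D D0 HD] := stage_slope_defect.
exists (2 + 2 * D) => a x x01; rewrite normr_id.
have cn : {within `[0, 1], continuous (fun z => `|e a z|)}.
  apply: (within_continuous_comp (g := fun y : 'rV[R]_m => `|y|)).
    exact: norm_continuous.
  exact: continuous_error.
have [z z01 zmax] := EVT_max ler01 cn.
have {}zmax y : 0 <= y <= 1 -> `|e a y| <= `|e a z|.
  by move=> y01; apply: zmax; rewrite in_itv.
move: z01; rewrite in_itv /= => z01.
have h0 := h_ge0 h01 a.
set M := `|e a z| in zmax *.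
set K := h a * (L * M + D * h a ^+ s).
have K0 : 0 <= K by rewrite !(mulr_ge0, addr_ge0) ?hX_ge0 // /M.
have inc : `|e a z - e a 0| <= K.
  apply: norm_le_coord => // i j; rewrite (ord1 i) {i}.
  have /andP[z0 z1] := z01.
  have c0z : {within `[0, z], continuous (fun y => e a y 0 j)}.
    have sub : [set` `[0, z]] `<=` [set` `[0, 1 : R]].
      by move=> y /=; rewrite !in_itv /= => /andP[-> /le_trans]; apply.
    exact: (continuous_subspaceW sub (@continuous_error_coord a j)).
  have := @increment_le R (fun y => e a y 0 j)
    (fun y => h a * (f (u a y) 0 j - dv a y 0 j)) 0 z K z0.
  rewrite subr0 !mxE => H; apply: le_trans (H _ _ _) _.
  - exact: c0z.
  - move=> y /andP[y0 yz]; apply: is_derive_error.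
    by rewrite y0 (lt_le_trans yz).
  - move=> y /andP[y0 yz]; have y01 : 0 <= y <= 1.
      by rewrite (ltW y0) (ltW (lt_le_trans yz z1)).
    rewrite normrM (ger0_norm h0) ler_wpM2l //.
    rewrite -[f _ 0 j](subrK (f (v a y) 0 j)) -addrA.
    rewrite (le_trans (ler_normD _ _)) // lerD ?HD //.
    have -> : f (u a y) 0 j - f (v a y) 0 j = (f (u a y) - f (v a y)) 0 j.
      by rewrite !mxE.
    rewrite (le_trans (le_coord_norm _ _ _)) // (le_trans (fL _ _)) ?uB ?vB //.
    by rewrite ler_wpM2l // zmax.
  - by rewrite ler_piMr.
have Mle : M <= d a + K.
  by rewrite /M -[e a z](subrK (e a 0)) addrC (le_trans (ler_normD _ _)) // lerD2l.
have hLM : h a * L * M <= 2^-1 * M by rewrite ler_wpM2r // /M.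
have d0 : 0 <= d a by rewrite /d.
have hs0 := hX_ge0 h01 a s.+1.
have Ddh : 0 <= D * d a by rewrite mulr_ge0.
apply: le_trans (zmax x x01) _.
have KE : K = h a * L * M + D * h a ^+ s.+1 by rewrite /K exprS; ring.
rewrite KE in Mle.
have : 2 * (d a + D * h a ^+ s.+1) <= (2 + 2 * D) * (d a + h a ^+ s.+1) by lra.
by apply: le_trans; lra.
Qed.

Let G a := d a + h a ^+ (2 * s).

Lemma error_coord_isO i : isO (fun a => d a + h a ^+ s.+1) (fun a x => e a x 0 i).
Proof.
have [C eC] := stage_error; exists C => a x x01.
by rewrite (le_trans (le_coord_norm _ _ _)) // -[leLHS]normr_id eC.
Qed.

Lemma d_ge0 a : 0 <= d a.
Proof. exact: normr_ge0. Qed.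

Lemma weight_ge0 a n : 0 <= d a + h a ^+ n.
Proof. by rewrite addr_ge0 ?d_ge0 ?hX_ge0. Qed.

Lemma weight_hX a : h a ^+ s * (d a + h a ^+ s.+1) <= G a.
Proof.
rewrite mulrDr -exprD lerD //.
  by rewrite ler_piMl ?d_ge0 // exprn_ile1 ?h_ge0 ?h_le1.
by apply: (hX_le h01); lia.
Qed.

(** The quadratic term of the linearization is harmless because the initial
    error is bounded and 2 (s + 1) >= 2 s. *)
Lemma weight_sqr a : (d a + h a ^+ s.+1) ^+ 2 <= (2 * B + 2) * G a.
Proof.
have d0 := d_ge0 a.
have dB : d a <= 2 * B.
  rewrite /d /e (le_trans (ler_normB _ _)) // mulr_natl mulr2n.
  by rewrite lerD ?uB ?vB ?lexx ?ler01.
have H0 := hX_ge0 h01 a s.+1; have H0' := hX_ge0 h01 a (2 * s).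
have H1 : h a ^+ s.+1 <= 1 by rewrite exprn_ile1 ?h_ge0 ?h_le1.
have H2 : h a ^+ s.+1 ^+ 2 <= h a ^+ (2 * s).
  by rewrite -exprM; apply: (hX_le h01); lia.
rewrite /G sqrrD.
have : d a ^+ 2 <= 2 * B * d a by rewrite expr2 ler_wpM2r.
have : d a * h a ^+ s.+1 <= d a by rewrite ler_piMr.
have : 0 <= 2 * B * h a ^+ (2 * s) by rewrite mulr_ge0 // (le_trans d0).
rewrite mulr2n; lra.
Qed.

(** Superconvergence at the end of the step. Pairing the error with the
    approximate adjoint Z cancels the linear term Df(v) e, so that the
    increment of Z.e is the integral of h Z.r, r being the defect. Up to
    O(h^(2s)) this is the integral of h Z times a residual, which
    is O(h^(2s+1)) because the components of Z are polynomials whose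
    coefficients of degree l are O(h^l). *)
Lemma step_error_coord k0 :
  isO (fun a => h a * G a) (fun a _ => e a 1 0 k0 - e a 0 0 k0).
Proof.
have G0 a : 0 <= G a := weight_ge0 a _.
have h0 a : 0 <= h a := h_ge0 h01 a.
have /choice[T HT] : forall i, exists T, hpoly h 0 T /\ bigO h (2 * s)
    (fun a x => f (v a x) 0 i - dv a x 0 i - (residual P s c b (T a)).[x]).
  by move=> i; have [T TO FT] := stage_defect HP Hord Hq c01 Cf h01 v_eq vB i;
    exists T.
have /choice[A HA] : forall ji : 'I_m * 'I_m, exists A, hpoly h 0 A /\
    bigO h s (fun a x => partial f ji.1 (v a x) 0 ji.2 - (A a).[x]).
  move=> ji; have ss : (s < 2 * s)%N by lia.
  by have [A AO FA] := taylor_partial_stage HP Hord Hq c01 Cf h01 v_eq vB ji.1 ji.2 ss;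
    exists A.
have [Z [ZO Z1 Zd ZA]] := approximate_adjoint h01 (A := fun j i => A (j, i)) k0
  (fun j i => (HA (j, i)).1) s.
pose W a := \sum_i Z i a * residual P s c b (T i a).
(* What is left of f(u) - f(v) + defect after removing its residual part and
   its linear part in the error. *)
pose err i a x := f (u a x) 0 i - dv a x 0 i - (residual P s c b (T i a)).[x]
  - \sum_j (A (j, i) a).[x] * e a x 0 j.
have errO i : isO G (err i).
  have [C C0 fC] := taylor2_ball B (class_C_le (ltac:(lia) : (2 <= 2 * s)%N) Cf).
  have O1 : isO G (fun a x => f (u a x) 0 i - f (v a x) 0 i -
      \sum_j e a x 0 j * partial f j (v a x) 0 i).
    have [D eD] := stage_error.
    exists (C * (D ^+ 2 * (2 * B + 2))) => a x x01.
    have uE : u a x = v a x + e a x by rewrite /e addrC subrK.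
    have veB : `|v a x + e a x| <= B by rewrite -uE uB.
    rewrite {1}uE; apply: le_trans (fC _ _ i (vB a x01) veB) _.
    rewrite -mulrA ler_wpM2l // -mulrA.
    apply: (@le_trans _ _ (D ^+ 2 * (d a + h a ^+ s.+1) ^+ 2)).
      rewrite -exprMn lerXn2r ?nnegrE //; last by rewrite -[leLHS]normr_id eD.
      by apply: le_trans (eD a x x01).
    by rewrite ler_wpM2l ?sqr_ge0 // weight_sqr.
  have O2 : isO G (fun a x => \sum_j
      (partial f j (v a x) 0 i - (A (j, i) a).[x]) * e a x 0 j).
    apply: isO_sum => j _.
    apply: (@isO_le _ _ _ _ 1) (isOM (HA (j, i)).2 (error_coord_isO j)) => a.
    by rewrite mul1r weight_hX mulr_ge0 ?weight_ge0 ?hX_ge0.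
  have O3 : isO G (fun a x =>
      f (v a x) 0 i - dv a x 0 i - (residual P s c b (T i a)).[x]).
    apply: (@isO_le _ _ _ _ 1) (HT i).2 => a.
    by rewrite mul1r hX_ge0 //= /G lerDr d_ge0.
  apply: isO_ext (isOD (isOD O1 O2) O3) => a x _; rewrite /err.
  have -> : \sum_j (partial f j (v a x) 0 i - (A (j, i) a).[x]) * e a x 0 j =
      \sum_j e a x 0 j * partial f j (v a x) 0 i -
      \sum_j (A (j, i) a).[x] * e a x 0 j.
    by rewrite -sumrB; apply: eq_bigr => j _; ring.
  ring.
pose g a x := \sum_i (Z i a).[x] * e a x 0 i - (h a *: prim (W a)).[x].
pose dg a x := \sum_j ((Z j a)^`().[x] +
    h a * \sum_i (Z i a).[x] * (A (j, i) a).[x]) * e a x 0 j +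
  h a * \sum_i (Z i a).[x] * err i a x.
have Dg a (x : R) : 0 < x < 1 -> is_derive x 1 (g a) (dg a x).
  move=> x01.
  have D1 : is_derive x 1 (\sum_i (fun z => (Z i a).[z] * e a z 0 i)) (\sum_i
      ((Z i a).[x] *: (h a * (f (u a x) 0 i - dv a x 0 i)) +
       e a x 0 i *: (Z i a)^`().[x])).
    apply: is_derive_sum => i; apply: is_deriveM.
    exact: is_derive_error.
  have D2 := is_derive_poly (h a *: prim (W a)) x.
  have D := is_deriveB D1 D2; rewrite fct_sumE in D; apply: (is_derive_eq D).
  rewrite derivZ deriv_prim hornerZ horner_sum /dg.
  have -> : \sum_i (Z i a).[x] * err i a x =
      \sum_i (Z i a).[x] * (f (u a x) 0 i - dv a x 0 i)
      - \sum_i (Z i a * residual P s c b (T i a)).[x]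
      - \sum_j (\sum_i (Z i a).[x] * (A (j, i) a).[x]) * e a x 0 j.
    under [X in _ = _ - X]eq_bigr do rewrite mulr_suml.
    rewrite exchange_big -!sumrB; apply: eq_bigr => i _ /=.
    rewrite hornerM /err mulrBr mulr_sumr -mulrBr; congr (_ - _).
    by apply: eq_bigr => j _; rewrite mulrA.
  under [X in _ = X + _]eq_bigr do rewrite mulrDl -mulrA.
  rewrite !big_split /= -!mulr_sumr.
  under [X in X + _ - _ = _]eq_bigr do rewrite [_ *: _]mulrCA.
  rewrite -mulr_sumr; under [X in _ + X - _ = _]eq_bigr do rewrite [_ *: _]mulrC.
  ring.
have dgO : isO (fun a => h a * G a) dg.
  apply: isOD.
    apply: isO_sum => j _.
    apply: (@isO_le _ _ _ _ 1) (isOM (ZA j) (error_coord_isO j)) => a.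
    rewrite mul1r mulr_ge0 ?weight_ge0 ?hX_ge0 //= [X in X * _]exprS -mulrA.
    by rewrite ler_wpM2l // weight_hX.
  have hO : isO h (fun a _ => h a) by exists 1 => a x _; rewrite mul1r ger0_norm.
  apply: isOM hO _; apply: isO_sum => i _.
  apply: (@isO_le _ _ _ _ 1) (isOM (hpoly_bigO h01 (ZO i)) (errO i)) => a.
  by rewrite expr0 !mul1r G0 lexx.
(* The derivative of g is O(h G) since the residual part has been subtracted. *)
have gO : isO (fun a => h a * G a) (fun a _ => g a 1 - g a 0).
  have [C gC] := dgO; exists C => a x _; rewrite -[leRHS]mulr1 -[X in _ * X](subr0 1).
  apply: (increment_le ler01 _ (Dg a)) => [|y /andP[y0 y1]]; last first.
    by apply: gC; rewrite (ltW y0) (ltW y1).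
  have cp (p : {poly R}) : {within `[0, 1], continuous (horner p)}.
    by apply: continuous_subspaceT => z; exact: continuous_horner.
  apply: within_continuousB; last exact: cp.
  apply: within_continuous_sum => i; apply: within_continuousM; first exact: cp.
  exact: continuous_error_coord.
have WO : isO (fun a => h a * G a) (fun a _ => h a * int01 (W a)).
  have [C WC] : bigO h (2 * s) (fun a _ => int01 (W a)).
    apply: (@isO_ext _ _ _ (fun a _ =>
        \sum_i int01 (Z i a * residual P s c b (T i a)))) => [a x _|].
      by rewrite /W linear_sum.
    apply: isO_sum => i _.
    exact: (int01_residual_small HP Hord Hq h01 (ZO i) (HT i).1).
  exists `|C| => a x x01; rewrite normrM ger0_norm // mulrCA ler_wpM2l //.
  rewrite (le_trans (WC a x x01)) // (le_trans (_ : _ <= `|C| * h a ^+ (2 * s))) //.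
    by rewrite ler_wpM2r ?hX_ge0 // ler_norm.
  by rewrite ler_wpM2l // /G lerDr d_ge0.
have ZO0 : isO (fun a => h a * G a)
    (fun a _ => \sum_i ((Z i a).[0] - (i == k0)%:R) * e a 0 0 i).
  apply: isO_sum => i _; have e0O : isO d (fun a _ => e a 0 0 i).
    by exists 1 => a x _; rewrite mul1r le_coord_norm.
  have I01 : 0 <= (0 : R) <= 1 by rewrite lexx ler01.
  apply: (@isO_le _ _ _ _ 1) (isOM (isO_at I01 (Zd i)) e0O) => a.
  rewrite mul1r expr1 mulr_ge0 ?d_ge0 //= ler_wpM2l // lerDl.
  exact: (hX_ge0 h01).
apply: isO_ext (isOD (isOD gO WO) ZO0) => a x _.
rewrite /g !hornerZ prim_horner0 mulr0 subr0 -/(int01 (W a)).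
under [X in X - _ - _ + _ + _ = _]eq_bigr do rewrite Z1.
under [X in _ + X = _]eq_bigr do rewrite mulrBl.
rewrite sumrB (bigD1 k0) //= eqxx mul1r big1 ?addr0; last first.
  by move=> i /negPf->; rewrite mul0r.
rewrite [X in _ + (_ - X) = _](bigD1 k0) //= eqxx mul1r.
rewrite [\sum_(i < m | i != k0) _]big1 ?addr0; last first.
  by move=> i /negPf->; rewrite mul0r.
ring.
Qed.

End StepError.

(** * Solvability of one step by contraction *)

(* Matrices carry a norm and are complete; their complete normed module
   structure is what the Banach fixed point theorem asks for. *)
HB.instance Definition _ (R : realType) m n :=
  Uniform_isComplete.Build 'M[R]_(m, n) (@mx_complete R m n).

Lemma fixed_point_in (R : realType) (X : completeNormedModType R) (U : set X)
    (F : X -> X) : closed U -> U !=set0 -> {homo F : x / U x >-> U x} ->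
  (forall x y, U x -> U y -> `|F x - F y| <= 2^-1 * `|x - y|) ->
  exists2 x, U x & x = F x.
Proof.
move=> cU U0 FU FL.
have ctr : is_contraction (mkfun_fun FU).
  exists (2^-1)%:nng; split=> /=; first by rewrite invf_lt1 // ltr1n.
  by move=> [x y] /= [Ux Uy]; exact: FL.
by have [x Ux xF] := banach_fixed_point ctr cU U0; exists x.
Qed.

Section OneStep.
Variables (R : realType) (m : nat) (f : 'rV[R]_m -> 'rV[R]_m).
Variables (P : nat -> {poly R}) (s k : nat) (c b : 'I_k -> R).
Hypothesis c01 : forall i, 0 <= c i <= 1.
Implicit Types (a : 'rV[R]_m) (w : R -> 'rV[R]_m) (g : 'M[R]_(s, m)).

Definition slopes w : 'M[R]_(s, m) :=
  \matrix_(j < s) \sum_(i < k) (b i * (P j).[c i]) *: f (w (c i)).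

Definition stage a (h : R) g (x : R) : 'rV[R]_m :=
  a + h *: \sum_(j < s) (prim (P j)).[x] *: row j g.

Lemma norm_row j g : `|row j g| <= `|g|.
Proof.
by apply: norm_le_coord => // i l; rewrite mxE le_coord_norm.
Qed.

Lemma stage_bound : exists2 C : R, 0 <= C & forall g x, 0 <= x <= 1 ->
  `|\sum_(j < s) (prim (P j)).[x] *: row j g| <= C * `|g|.
Proof.
pose D (j : 'I_s) := \sum_(l < size (prim (P j))) `|(prim (P j))`_l|.
exists (\sum_j D j) => [|g x /andP[x0 x1]].
  by apply: sumr_ge0 => j _; apply: sumr_ge0.
rewrite (le_trans (ler_norm_sum _ _ _)) // mulr_suml ler_sum // => j _.
rewrite normrZ ler_pM ?norm_row // horner_coef (le_trans (ler_norm_sum _ _ _)) //.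
apply: ler_sum => l _.
by rewrite normrM ler_piMr // normrX ger0_norm // exprn_ile1.
Qed.

Lemma slopes_bound : exists2 C : R, 0 <= C & forall (z : 'I_k -> 'rV[R]_m) D,
  0 <= D -> (forall i, `|z i| <= D) ->
  `|\matrix_(j < s) \sum_(i < k) (b i * (P j).[c i]) *: z i| <= C * D.
Proof.
exists (\sum_(j < s) \sum_(i < k) `|b i * (P j).[c i]|) => [|z D D0 zD].
  by apply: sumr_ge0 => j _; apply: sumr_ge0.
apply: norm_le_coord => [|j l].
  by rewrite mulr_ge0 // sumr_ge0 // => j _; apply: sumr_ge0.
rewrite mxE (le_trans (le_coord_norm _ _ _)) // (le_trans (ler_norm_sum _ _ _)) //.
apply: (@le_trans _ _ (\sum_(i < k) `|b i * (P j).[c i]| * D)).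
  by apply: ler_sum => i _; rewrite normrZ ler_wpM2l.
rewrite -mulr_suml ler_wpM2r // [leRHS](bigD1 j) //= lerDl.
by apply: sumr_ge0 => i _; apply: sumr_ge0.
Qed.

Hypothesis Cf : class_C 1 f.

(** The unknown polynomial enters the equation for the slopes only through the
    term of size h, hence the factor 1/2 for small h. *)
Lemma slopes_contraction B : exists2 h0 : R, 0 < h0 &
  forall h a g g', 0 < h <= h0 ->
    (forall x, 0 <= x <= 1 -> `|stage a h g x| <= B) ->
    (forall x, 0 <= x <= 1 -> `|stage a h g' x| <= B) ->
  `|slopes (stage a h g) - slopes (stage a h g')| <= 2^-1 * `|g - g'|.
Proof.
have [L L0 fL] := lipschitz_ball B Cf.
have [Cq Cq0 HCq] := stage_bound; have [Cb Cb0 HCb] := slopes_bound.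
have C1 : 0 < Cb * L * Cq + 1 by rewrite ltr_wpDl // !mulr_ge0.
exists (2^-1 / (Cb * L * Cq + 1)); first by rewrite divr_gt0 // invr_gt0.
move=> h a g g' /andP[h0 hle] gB g'B.
have -> : slopes (stage a h g) - slopes (stage a h g') =
    \matrix_(j < s) \sum_(i < k) (b i * (P j).[c i]) *:
      (f (stage a h g (c i)) - f (stage a h g' (c i))).
  apply/matrixP => j l; rewrite !mxE !summxE -sumrB; apply: eq_bigr => i _.
  by rewrite !mxE mulrBr.
have E0 : 0 <= L * (h * (Cq * `|g - g'|)).
  by rewrite !mulr_ge0 // ltW.
apply: le_trans (HCb _ _ E0 _) _ => [i|].
  rewrite (le_trans (fL _ _ (gB _ (c01 i)) (g'B _ (c01 i)))) // ler_wpM2l //.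
  have -> : stage a h g (c i) - stage a h g' (c i) =
      h *: \sum_(j < s) (prim (P j)).[c i] *: row j (g - g').
    rewrite /stage opprD addrACA subrr add0r -scalerBr -sumrB; congr (_ *: _).
    by apply: eq_bigr => j _; rewrite linearB scalerBr.
  by rewrite normrZ gtr0_norm // ler_wpM2l ?HCq // ltW.
have -> : Cb * (L * (h * (Cq * `|g - g'|))) = h * (Cb * L * Cq) * `|g - g'|.
  by ring.
rewrite ler_wpM2r // (le_trans _ (_ : h * (Cb * L * Cq + 1) <= _)) //.
  by rewrite ler_wpM2l ?lerDl // ltW.
by rewrite -ler_pdivlMr.
Qed.

Lemma slopes_unique B : exists2 h0 : R, 0 < h0 &
  forall h a g g', 0 < h <= h0 ->
    g = slopes (stage a h g) -> g' = slopes (stage a h g') ->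
    (forall x, 0 <= x <= 1 -> `|stage a h g x| <= B) ->
    (forall x, 0 <= x <= 1 -> `|stage a h g' x| <= B) -> g = g'.
Proof.
have [h0 h0_gt0 H] := slopes_contraction B.
exists h0 => // h a g g' hh0 gE g'E gB g'B.
have := H h a g g' hh0 gB g'B; rewrite -gE -g'E.
move=> H'; apply/eqP; rewrite -subr_eq0 -normr_eq0 eq_le normr_ge0 andbT.
by have : 0 <= `|g - g'| by []; lra.
Qed.

(** Slopes bounded by the sup of f on the ball move v by O(h), so for small h
    the fixed point map preserves the set of such slopes. *)
Lemma slopes_exist K r : 0 < r -> exists2 h0 : R, 0 < h0 &
  forall h a, 0 < h <= h0 -> `|a| <= K ->
  exists2 g, g = slopes (stage a h g) &
    forall x, 0 <= x <= 1 -> `|stage a h g x - a| <= r.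
Proof.
move=> r0; have [h1 h1_gt0 Hc] := slopes_contraction (K + r).
have [M M0 fM] := continuous_bounded_ball (K + r) (class_C_continuous Cf).
have [Cq Cq0 HCq] := stage_bound; have [Cb Cb0 HCb] := slopes_bound.
have C1 : 0 < Cq * (Cb * M) + 1 by rewrite ltr_wpDl // !mulr_ge0.
exists (Num.min h1 (r / (Cq * (Cb * M) + 1))).
  by rewrite lt_min h1_gt0 divr_gt0.
move=> h a /andP[h0]; rewrite le_min => /andP[hh1 hle] aK.
pose U := [set g : 'M[R]_(s, m) | `|g| <= Cb * M].
have near g : U g -> forall x, 0 <= x <= 1 -> `|stage a h g x - a| <= r.
  move=> Ug x x01; rewrite /stage [a + _]addrC addrK normrZ gtr0_norm //.
  apply: (@le_trans _ _ (h * (Cq * (Cb * M) + 1))); last by rewrite -ler_pdivlMr.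
  rewrite ler_wpM2l ?(ltW h0) // (le_trans (HCq _ _ x01)) //.
  by rewrite (le_trans (_ : _ <= Cq * (Cb * M))) ?ler_wpM2l ?lerDl.
have inB g : U g -> forall x, 0 <= x <= 1 -> `|stage a h g x| <= K + r.
  move=> Ug x x01; rewrite -[stage _ _ _ _](subrK a) addrC.
  by rewrite (le_trans (ler_normD _ _)) // lerD // near.
have [||g Ug|g g' Ug Ug'|g Ug gE] := @fixed_point_in R 'M[R]_(s, m) U
    (fun g => slopes (stage a h g)).
- by apply: closed_comp (@closed_le _ _) => x _; exact: norm_continuous.
- by exists 0; rewrite /U /= normr0 mulr_ge0.
- by apply: HCb => // i; apply: fM; apply: inB.
- by apply: Hc; rewrite ?h0 //; exact: inB.
- by exists g => //; exact: near.
Qed.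

End OneStep.

(** * Uniform one-step error bound *)

Section LocalStep.
Variables (R : realType) (m : nat) (f : 'rV[R]_m -> 'rV[R]_m).
Variables (P : nat -> {poly R}) (s k q : nat) (c b : 'I_k -> R).
Hypotheses (HP : legendre_basis P) (Hord : quadrature_order c b q).
Hypotheses (Hs : (1 <= s)%N) (Hq : (2 * s <= q)%N).
Hypothesis c01 : forall i, 0 <= c i <= 1.
Hypothesis Cf : class_C (2 * s) f.

(** The index type of the family to which the one-step analysis is applied:
    one step of the scheme, paired with an exact trajectory over the same time
    span that need not start from the same value. *)
Record step_data (B h0 : R) := StepData {
  sd_h : R;
  sd_y : 'rV[R]_m;
  sd_g : 'M[R]_(s, m);
  sd_u : R -> 'rV[R]_m;
  sd_h0 : 0 < sd_h <= h0;
  sd_slopes : sd_g = slopes f P s c b (stage P sd_y sd_h sd_g);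
  sd_stageB : forall x, 0 <= x <= 1 -> `|stage P sd_y sd_h sd_g x| <= B;
  sd_uB : forall x, 0 <= x <= 1 -> `|sd_u x| <= B;
  sd_cont : {within `[0, 1], continuous sd_u};
  sd_derive : forall x : R, 0 < x < 1 ->
    is_derive x 1 sd_u (sd_h *: f (sd_u x)) }.

Lemma stage0 (y0 : 'rV[R]_m) h (g : 'M[R]_(s, m)) : stage P y0 h g 0 = y0.
Proof.
rewrite /stage big1 ?scaler0 ?addr0 // => j _.
by rewrite prim_horner0 scale0r.
Qed.

Lemma stage_eq (y0 : 'rV[R]_m) h (g : 'M[R]_(s, m)) :
  g = slopes f P s c b (stage P y0 h g) -> forall x,
  stage P y0 h g x = stage P y0 h g 0 + h *: \sum_(j < s) (prim (P j)).[x] *: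
    \sum_(i < k) (b i * (P j).[c i]) *: f (stage P y0 h g (c i)).
Proof.
move=> gE x; rewrite stage0 {1}/stage; congr (_ + _ *: _).
by apply: eq_bigr => j _; rewrite {1}gE rowK.
Qed.

Lemma continuous_stage (y0 : 'rV[R]_m) h (g : 'M[R]_(s, m)) :
  g = slopes f P s c b (stage P y0 h g) -> continuous (stage P y0 h g).
Proof.
move=> /stage_eq gE x; apply: differentiable_continuous; apply/derivable1_diffP.
by case: (@is_derive_stage _ _ f P s k c b unit (fun=> h)
  (fun=> stage P y0 h g) (fun=> gE) tt x).
Qed.

Lemma step_error B : exists C h0 : R, [/\ 0 <= C, 0 < h0 &
  forall D : step_data B h0,
    let h := sd_h D in let v := stage P (sd_y D) h (sd_g D) in let u := sd_u D in
    (forall x, 0 <= x <= 1 ->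
       `|u x - v x| <= C * (`|u 0 - sd_y D| + h ^+ s.+1)) /\
    `|(u 1 - v 1) - (u 0 - sd_y D)|
       <= C * (h * (`|u 0 - sd_y D| + h ^+ (2 * s)))].
Proof.
have s2 : (1 <= 2 * s)%N by lia.
have [L L0 fL] := lipschitz_ball B (class_C_le s2 Cf).
have L1 : 0 < 2 * (L + 1) by rewrite mulr_gt0 // ltr_wpDl.
(* The bound on h gives h L <= 1/2, also when L = 0. *)
pose h0 := Num.min 1 (2 * (L + 1))^-1.
have h0_gt0 : 0 < h0 by rewrite lt_min ltr01 invr_gt0.
pose h (D : step_data B h0) := sd_h D.
pose v (D : step_data B h0) := stage P (sd_y D) (sd_h D) (sd_g D).
pose u (D : step_data B h0) := sd_u D.
have h01 D : 0 < h D <= 1.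
  by have := sd_h0 D; rewrite le_min => /and3P[-> ->].
have hL D : h D * L <= 2^-1.
  have := sd_h0 D; rewrite le_min => /and3P[hD _].
  have L1' : 0 < L + 1 by rewrite ltr_wpDl.
  rewrite invfM ler_pdivlMr //; apply: le_trans.
  by rewrite -/(h D) ler_wpM2l ?lerDl // ltW.
have v0 D : v D 0 = sd_y D by rewrite /v stage0.
have v_eq D x : v D x = v D 0 + h D *: \sum_(j < s) (prim (P j)).[x] *:
    \sum_(i < k) (b i * (P j).[c i]) *: f (v D (c i)).
  exact: stage_eq (sd_slopes D) x.
have vB D x : 0 <= x <= 1 -> `|v D x| <= B by exact: sd_stageB.
have uB D x : 0 <= x <= 1 -> `|u D x| <= B by exact: sd_uB.
have cu D : {within `[0, 1], continuous (u D)} by exact: sd_cont.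
have Du D (x : R) : 0 < x < 1 -> is_derive x 1 (u D) (h D *: f (u D x)).
  exact: sd_derive.
have [C1 C1e] := stage_error HP Hord Hs Hq c01 Cf L0 fL h01 hL v_eq vB uB cu Du.
have /choice[C2 C2e] := step_error_coord HP Hord Hs Hq c01 Cf L0 fL h01 hL v_eq
  vB uB cu Du.
exists (`|C1| + \sum_i `|C2 i|), h0; split=> // [|D].
  by rewrite addr_ge0 // sumr_ge0.
have w0 n : 0 <= `|u D 0 - v D 0| + h D ^+ n.
  by rewrite addr_ge0 // hX_ge0.
have S0 : 0 <= \sum_i `|C2 i| by rewrite sumr_ge0.
rewrite /= -/(u D) -/(v D) -/(h D) -(v0 D); split=> [x x01|].
  have := C1e D x x01; rewrite normr_id => /le_trans-> //.
  by rewrite ler_wpM2r // (le_trans (ler_norm _)) // lerDl.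
apply: norm_le_coord => [|i j].
  by apply: mulr_ge0; [exact: addr_ge0 | exact: mulr_ge0 (h_ge0 h01 D) _].
rewrite (ord1 i); have := C2e j D 0; rewrite lexx ler01 !mxE => /(_ isT)/le_trans-> //.
rewrite ler_wpM2r ?mulr_ge0 ?(h_ge0 h01) // (le_trans (ler_norm _)) //.
by rewrite (bigD1 j) //= addrCA lerDl addr_ge0 // sumr_ge0.
Qed.

End LocalStep.

(** * Equivalence of vector norms *)

Section VectorNorm.
Variables (R : realType) (m : nat) (nrm : 'rV[R]_m -> R).
Hypothesis Hnrm : vector_norm nrm.

Lemma vector_norm0 : nrm 0 = 0.
Proof. by have := vector_normZ Hnrm 0 0; rewrite scale0r normr0 mul0r. Qed.

Lemma vector_normN x : nrm (- x) = nrm x.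
Proof. by rewrite -scaleN1r (vector_normZ Hnrm) normrN1 mul1r. Qed.

Lemma vector_norm_ge0 x : 0 <= nrm x.
Proof.
have := vector_normD Hnrm x (- x); rewrite subrr vector_norm0 vector_normN; lra.
Qed.

Lemma vector_norm_sum (J : Type) (r : seq J) (F : J -> 'rV[R]_m) :
  nrm (\sum_(j <- r) F j) <= \sum_(j <- r) nrm (F j).
Proof.
elim: r => [|j r IHr]; first by rewrite !big_nil vector_norm0.
by rewrite !big_cons (le_trans (vector_normD Hnrm _ _)) // lerD2l.
Qed.

Lemma vector_norm_le_max : exists2 C : R, 0 < C & forall x, nrm x <= C * `|x|.
Proof.
exists (\sum_i nrm (delta_mx 0 i) + 1) => [|x].
  by rewrite ltr_wpDl // sumr_ge0 // => i _; exact: vector_norm_ge0.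
rewrite {1}(row_sum_delta x) (le_trans (vector_norm_sum _ _)) //.
rewrite mulrDl mul1r (le_trans _ (_ : (\sum_i nrm (delta_mx 0 i)) * `|x| <= _)) //.
  rewrite mulr_suml ler_sum // => i _; rewrite (vector_normZ Hnrm) mulrC.
  by rewrite ler_wpM2l ?vector_norm_ge0 // le_coord_norm.
by rewrite lerDl.
Qed.

Lemma vector_norm_continuous : continuous nrm.
Proof.
have [C C0 nC] := vector_norm_le_max.
have dist x z : `|nrm x - nrm z| <= C * `|x - z|.
  have tri x' z' : nrm x' - nrm z' <= nrm (x' - z').
    by rewrite lerBlDr -{1}(subrK z' x') (vector_normD Hnrm).
  rewrite (le_trans _ (nC _)) // ler_norml tri andbT lerNl opprB.
  by rewrite -(vector_normN (x - z)) opprB tri.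
move=> x; apply/(@cvgrPdist_le _ _ _ (nbhs x) (nbhs_filter x)) => eps eps0.
have eC : 0 < eps / C by rewrite divr_gt0.
apply: filterS (nbhsx_ballx x _ eC) => z; rewrite -ball_normE /= => xz.
by rewrite (le_trans (dist _ _)) // mulrC -ler_pdivlMr // ltW.
Qed.

(** The norm attains a positive minimum on the compact unit sphere of the
    max-norm. *)
Lemma max_le_vector_norm : exists2 C : R, 0 < C & forall x, `|x| <= C * nrm x.
Proof.
pose S := [set x : 'rV[R]_m | `|x| = 1].
have [S0|S0] := pselect (S !=set0); last first.
  exists 1 => // x; rewrite mul1r; have [->|x0] := eqVneq x 0.
    by rewrite normr0 vector_norm0.
  case: S0; exists (`|x|^-1 *: x); rewrite /S /= normrZ normfV normr_id mulVf //.
  by rewrite normr_eq0.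
have cS : compact S.
  apply: bounded_closed_compact.
    exists 1; split; first exact: num_real.
    by move=> y y1 x /= ->; exact: ltW.
  by apply: closed_comp (@closed_eq _ 1) => x _; exact: norm_continuous.
have [z zS zmin] := EVT_min_rV S0 cS (continuous_subspaceT vector_norm_continuous).
move: zS; rewrite inE /S /= => z1.
have nz0 : 0 < nrm z.
  rewrite lt_neqAle vector_norm_ge0 andbT eq_sym; apply/eqP.
  by move=> /(vector_norm0_eq0 Hnrm) z0; move/eqP: z1; rewrite z0 normr0 eq_sym oner_eq0.
exists (nrm z)^-1 => [|x]; first by rewrite invr_gt0.
have [->|x0] := eqVneq x 0; first by rewrite normr0 vector_norm0 mulr0.
have nx0 : 0 < `|x| by rewrite normr_gt0.
have : nrm z <= nrm (`|x|^-1 *: x).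
  by apply: zmin; rewrite inE /S /= normrZ normfV normr_id mulVf // gt_eqF.
rewrite (vector_normZ Hnrm) normfV normr_id ler_pdivlMl // => H.
by rewrite mulrC ler_pdivlMr.
Qed.

End VectorNorm.

(** * The exact solution *)

Section Solution.
Variables (R : realType) (m : nat) (f : 'rV[R]_m -> 'rV[R]_m) (t0 T : R).
Variable y : R -> 'rV[R]_m.
Hypothesis Dy : forall t, t0 <= t <= T -> derivative_within `[t0, T] y t (f (y t)).

(** The difference quotient condition of a one-sided or two-sided derivative,
    in epsilon-delta form. *)
Lemma solution_quotient t (eps : R) : t0 <= t <= T -> 0 < eps ->
  exists2 d : R, 0 < d & forall r, `|t - r| < d -> r != t -> t0 <= r <= T ->
    `|f (y t) - (r - t)^-1 *: (y r - y t)| <= eps.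
Proof.
move=> tT eps0; have /cvgrPdist_le/(_ _ eps0) := Dy tT.
by rewrite near_withinE => /nbhs_ballP[d d0 H]; exists d.
Qed.

Lemma solution_continuous : {within `[t0, T], continuous y}.
Proof.
apply/subspace_continuousP => t /=; rewrite in_itv /= => tT.
apply/cvgrPdist_le => eps eps0.
have [d d0 H] := solution_quotient tT (ltr01 : 0 < (1 : R)).
have C0 : 0 < `|f (y t)| + 1 by rewrite ltr_wpDl.
rewrite near_withinE; apply/nbhs_ballP.
exists (Num.min d (eps / (`|f (y t)| + 1))); first by rewrite /= lt_min d0 divr_gt0.
move=> r; rewrite -ball_normE /= lt_min => /andP[rd re]; rewrite in_itv /= => rT.
have [->|rt] := eqVneq r t; first by rewrite subrr normr0 ltW.
have rt0 : r - t != 0 by rewrite subr_eq0.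
have -> : y t - y r = (t - r) *: ((r - t)^-1 *: (y r - y t)).
  by rewrite -(opprB r t) scaleNr scalerA mulfV // scale1r opprB.
rewrite normrZ (le_trans (ler_wpM2l _ (_ : _ <= `|f (y t)| + 1))) //.
  rewrite -[X in `|X| <= _](subrK (f (y t))) addrC (le_trans (ler_normD _ _)) //.
  by rewrite lerD2l distrC H.
by rewrite -ler_pdivlMr // ltW.
Qed.

Lemma is_derive_solution t : t0 < t < T -> is_derive t 1 y (f (y t)).
Proof.
move=> /andP[t0t tT].
have tT' : t0 <= t <= T by rewrite !ltW.
suff cvgq : (fun h : R => h^-1 *: ((y \o shift t) (h *: 1) - y t)) @ 0^' --> f (y t).
  by apply: DeriveDef; [apply/cvg_ex; exists (f (y t)) | exact: cvg_lim cvgq].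
apply/cvgrPdist_le => eps eps0.
have [d d0 H] := solution_quotient tT' eps0.
apply/nbhs_ballP; exists (Num.min d (Num.min (t - t0) (T - t))).
  by rewrite /= !lt_min d0 !subr_gt0 t0t tT.
move=> h; rewrite -ball_normE /= sub0r normrN !lt_min => /and3P[hd ht0 hT] h0.
rewrite [h *: 1]mulr1; have := H (h + t).
rewrite addrK opprD addrCA subrr addr0 normrN -subr_eq0 addrK; apply=> //.
move: ht0 hT; rewrite !ltr_norml => /andP[? _] /andP[_ ?].
by apply/andP; split; lra.
Qed.

Lemma solution_bounded : exists2 B : R, 0 <= B & forall t, t0 <= t <= T -> `|y t| <= B.
Proof.
have [T0|T0] := leP t0 T; last first.
  by exists 0 => // t /andP[t0t tT]; have := lt_le_trans T0 (le_trans t0t tT);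
     rewrite ltxx.
have cn : {within `[t0, T], continuous (fun t => `|y t|)}.
  have cy := solution_continuous => t.
  by exact: (@continuous_comp _ _ _ _ _ t (cy t) (@norm_continuous _ _ (y t))).
have [z _ zmax] := EVT_max T0 cn.
by exists `|y z| => // t tT; apply: zmax; rewrite in_itv.
Qed.

Lemma continuous_solution_rescaled a h :
  (forall x, 0 <= x <= 1 -> t0 <= a + x * h <= T) ->
  {within `[0, 1], continuous (fun x => y (a + x * h))}.
Proof.
move=> aT; apply/subspace_continuousP => x /=; rewrite in_itv /= => x01.
have cw : continuous (fun z : R => a + z * h).
  have -> : (fun z : R => a + z * h) = horner (h *: 'X + a%:P).
    by apply/funext => z; rewrite !hornerE addrC mulrC.
  exact: continuous_horner.
have axT : [set` `[t0, T]] (a + x * h) by rewrite /= in_itv /= aT.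
have /subspace_continuousP/(_ _ axT) cy := solution_continuous.
apply: (cvg_comp (fun z : R => a + z * h) y _ cy) => A yA.
have nA : nbhs x (fun z : R => [set` `[t0, T]] (a + z * h) -> A (a + z * h)).
  exact: (cw x _ yA).
apply: (@filterS _ (nbhs x) _ _ _ _ nA) => z zA z01; apply: zA.
by move: z01; rewrite /= !in_itv /=; exact: aT.
Qed.

Lemma is_derive_solution_rescaled a h (x : R) : t0 < a + x * h < T ->
  is_derive x 1 (fun z => y (a + z * h)) (h *: f (y (a + x * h))).
Proof.
move=> tT; pose w (z : R) := a + z * h.
have Dw : is_derive x 1 w h.
  have : is_derive x 1 (fun z : R => a + z * h) (0 + (x *: 0 + h *: 1)).
    by apply: is_deriveD; apply: is_deriveM.
  by rewrite scaler0 !add0r [_ *: _]mulr1.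
have [dy Ey] := is_derive_solution tT.
have dfy : differentiable y (w x) by apply/derivable1_diffP.
have Eh : 'D_h y (w x) = h *: 'D_1 y (w x).
  rewrite (deriveE _ dfy) (deriveE _ dfy).
  transitivity ('d y (w x) (h *: (1 : R))).
    by congr ('d y (w x) _); rewrite [_ *: _]mulr1.
  exact: linearZ.
have := is_derive_comp_curve dfy Dw; rewrite Eh Ey; exact.
Qed.

End Solution.

(** * Runs of the scheme *)

Section Run.
Variables (R : realType) (m : nat) (nrm : 'rV[R]_m -> R).
Variables (f : 'rV[R]_m -> 'rV[R]_m) (P : nat -> {poly R}) (s k : nat).
Variables (c b : 'I_k -> R) (rho h : R) (y0 : 'rV[R]_m).
Hypotheses (c01 : forall i, 0 <= c i <= 1) (h0 : 0 < h).
Implicit Types (yn : nat -> 'rV[R]_m) (u : nat -> R -> 'rV[R]_m) (N n : nat).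
Local Notation run := (scheme_run nrm f P s c b rho h).

(** The matrix g collects the coefficients gamma_j; the implicit equation of
    the step is a fixed point equation for g alone. *)
Lemma run_stage N yn u n : run N y0 yn u -> (1 <= n <= N)%N ->
  exists g : 'M[R]_(s, m), [/\ g = slopes f P s c b (stage P (yn n.-1) h g),
    forall x, 0 <= x <= 1 -> u n (x * h) = stage P (yn n.-1) h g x
    & yn n = stage P (yn n.-1) h g 1].
Proof.
move=> ru n1; pose g := \matrix_(j < s) gamma_hat f P c b h (u n) j.
have uE x : 0 <= x <= 1 -> u n (x * h) = stage P (yn n.-1) h g x.
  move=> x01; rewrite (run_poly ru n1 x01); congr (_ + _ *: _).
  apply: eq_bigr => j _; rewrite rowK integral_polyE //.
  by case/andP: x01.
exists g; split=> //; last by rewrite (run_step ru n1) -{1}(mul1r h) uE // ler01 lexx.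
apply/matrixP => j l; rewrite !mxE; congr ((_ : 'rV_m) _ _).
by apply: eq_bigr => i _; rewrite uE.
Qed.

Lemma run_extend N yn u (g : 'M[R]_(s, m)) : run N y0 yn u ->
  g = slopes f P s c b (stage P (yn N) h g) ->
  (forall x, 0 <= x <= 1 -> nrm (stage P (yn N) h g x - yn N) <= rho) ->
  exists yn' u', run N.+1 y0 yn' u'.
Proof.
move=> ru gE gN.
pose yn' i := if (i <= N)%N then yn i else stage P (yn N) h g 1.
pose u' i := if (i <= N)%N then u i else fun t => stage P (yn N) h g (t / h).
have last_or n : (1 <= n <= N.+1)%N -> (1 <= n <= N)%N \/ n = N.+1.
  by rewrite [(n <= N.+1)%N]leq_eqVlt ltnS => /andP[-> /predU1P[->|->]]; [right|left].
have hh x : x * h / h = x by rewrite mulfK // gt_eqF.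
exists yn', u'; split=> [|n|n|n].
- by rewrite /yn' leq0n (run_init ru).
- case/last_or => [n1|->] x x01.
    have /andP[n0 nN] := n1; have nN' : (n.-1 <= N)%N by rewrite (leq_trans (leq_pred _)).
    by rewrite /u' /yn' nN nN' (run_poly ru n1 x01).
  rewrite /u' /yn' ltnn leqnn hh {1}/stage; congr (_ + _ *: _).
  apply: eq_bigr => j _; rewrite integral_polyE; last by case/andP: x01.
  congr (_ *: _); rewrite {1}gE rowK /gamma_hat.
  by apply: eq_bigr => i _; rewrite hh.
- case/last_or => [n1|->].
    by have /andP[n0 nN] := n1; rewrite /u' /yn' nN (run_step ru n1).
  by rewrite /u' /yn' ltnn divff // gt_eqF.
- case/last_or => [n1|->] x x01.
    have /andP[n0 nN] := n1; have nN' : (n.-1 <= N)%N by rewrite (leq_trans (leq_pred _)).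
    by rewrite /u' /yn' nN nN' (run_near ru n1 x01).
  by rewrite /u' /yn' ltnn leqnn hh gN.
Qed.

End Run.

(** * Global error, existence and uniqueness *)

Section Global.
Variables (R : realType) (m : nat) (nrm : 'rV[R]_m -> R)
  (f : 'rV[R]_m -> 'rV[R]_m) (t0 T : R) (y0 : 'rV[R]_m) (y : R -> 'rV[R]_m)
  (P : nat -> {poly R}) (s k q : nat) (c b : 'I_k -> R) (rho : R)
  (Hnrm : vector_norm nrm)
  (Hs : (1 <= s)%N)
  (Hf : class_C (2 * s) f)
  (HT : t0 < T)
  (Hy : ivp_solution f t0 T y0 y)
  (HP : legendre_basis P)
  (c01 : forall i, 0 <= c i <= 1)
  (Hord : quadrature_order c b q)
  (Hq : (2 * s <= q)%N)
  (Hrho : 0 < rho).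

Variables (B0 c1 : R).
Hypothesis yB : forall t, t0 <= t <= T -> `|y t| <= B0.
Hypothesis le_nrm : forall x, `|x| <= c1 * nrm x.
Hypothesis c1_gt0 : 0 < c1.

Let B := B0 + 1 + c1 * rho.
Local Notation t h n := (t0 + n%:R * h).
Local Notation run := (scheme_run nrm f P s c b rho).
Implicit Types (yn : nat -> 'rV[R]_m) (u : nat -> R -> 'rV[R]_m) (N n : nat).

Lemma near_norm a z : `|a| <= B0 + 1 -> nrm (z - a) <= rho -> `|z| <= B.
Proof.
move=> aB za; rewrite -(subrK a z) addrC (le_trans (ler_normD _ _)) //.
by rewrite lerD // (le_trans (le_nrm _)) // ler_wpM2l // ltW.
Qed.

Lemma grid_in (h x : R) N n : 0 < h -> N%:R * h = T - t0 -> (1 <= n <= N)%N ->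
  0 <= x <= 1 -> t0 <= t h n.-1 + x * h <= T.
Proof.
move=> h0 Nh /andP[n0 nN] /andP[x0 x1].
have xh : 0 <= x * h <= h by rewrite mulr_ge0 ?ler_piMl ?(ltW h0).
have n1h : 0 <= n.-1%:R * h by rewrite mulr_ge0 ?ler0n ?(ltW h0).
have nh : n.-1%:R * h + h <= N%:R * h.
  by rewrite -{2}(mul1r h) -mulrDl natr1 prednK // ler_wpM2r ?(ltW h0) ?ler_nat.
case/andP: xh => ? ?; apply/andP; split; lra.
Qed.

Lemma gridS (h : R) n : (1 <= n)%N -> t h n = t h n.-1 + 1 * h.
Proof. by move=> n1; rewrite mul1r -{1}(prednK n1) -natr1 mulrDl mul1r addrA. Qed.

Lemma run_step_error : exists C h0 : R, [/\ 0 <= C, 0 < h0 &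
  forall h N N' yn u, 0 < h <= h0 -> N%:R * h = T - t0 -> (N' <= N)%N ->
    run h N' y0 yn u -> forall n, (1 <= n <= N')%N ->
    `|y (t h n.-1) - yn n.-1| <= 1 ->
    [/\ forall x, 0 <= x <= 1 -> `|y (t h n.-1 + x * h) - u n (x * h)|
          <= C * (`|y (t h n.-1) - yn n.-1| + h ^+ s.+1)
      & `|(y (t h n) - yn n) - (y (t h n.-1) - yn n.-1)|
          <= C * (h * (`|y (t h n.-1) - yn n.-1| + h ^+ (2 * s)))]].
Proof.
have [C [h0 [C0 h0_gt0 H]]] := step_error HP Hord Hs Hq c01 Hf B.
exists C, h0; split=> // h N N' yn u hh0 Nh NN' ru n n1 e1.
have /andP[h_gt0 _] := hh0.
have n1N : (1 <= n <= N)%N.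
  by case/andP: n1 => -> /= nN'; exact: leq_trans nN' NN'.
have [g [gE uE ynE]] := run_stage c01 ru n1.
have I0 : 0 <= (0 : R) <= 1 by rewrite lexx ler01.
have I1 : 0 <= (1 : R) <= 1 by rewrite ler01 lexx.
have yt x : 0 <= x <= 1 -> t0 <= t h n.-1 + x * h <= T.
  by move=> x01; exact: (grid_in h_gt0 Nh n1N x01).
have anB : `|yn n.-1| <= B0 + 1.
  have -> : yn n.-1 = y (t h n.-1) - (y (t h n.-1) - yn n.-1) by rewrite subKr.
  rewrite (le_trans (ler_normB _ _)) // lerD //.
  by have := yt 0 I0; rewrite mul0r addr0; exact: yB.
have gB x : 0 <= x <= 1 -> `|stage P (yn n.-1) h g x| <= B.
  move=> x01; apply: (near_norm anB).
  by rewrite -uE //; exact: (run_near ru n1).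
have wB x : 0 <= x <= 1 -> `|y (t h n.-1 + x * h)| <= B.
  by move=> x01; rewrite (le_trans (yB (yt _ x01))) // /B -addrA lerDl
    addr_ge0 ?mulr_ge0 // ltW.
have cw : {within `[0, 1], continuous (fun x => y (t h n.-1 + x * h))}.
  exact: (continuous_solution_rescaled Hy.2).
have Dw (x : R) : 0 < x < 1 -> is_derive x 1 (fun x => y (t h n.-1 + x * h))
    (h *: f (y (t h n.-1 + x * h))).
  move=> /andP[x0 x1]; apply: (is_derive_solution_rescaled Hy.2).
  have /andP[? _] := yt 0 I0; have /andP[_ ?] := yt 1 I1.
  have : 0 < x * h by rewrite mulr_gt0.
  have : x * h < 1 * h by rewrite ltr_pM2r.
  by move=> *; apply/andP; split; lra.
have [H1 H2] := H (StepData hh0 gE gB wB cw Dw).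
move: H1 H2; rewrite /= mul0r addr0 => H1 H2; split=> [x x01|].
  by rewrite uE // H1.
by rewrite (gridS _ (proj1 (andP n1))) ynE.
Qed.


(** Discrete Gronwall argument. The errors at the grid points obey
    |e_n| <= (1 + C h) |e_(n-1)| + C h h^(2s), hence
    |e_n| <= ((1 + C h)^n - 1) h^(2s) <= exp (C (T - t0)) h^(2s). For small h
    this is at most 1, which in turn keeps the numerical solution in the ball
    where the one-step bound holds. Truncated runs, with N' <= N steps, are
    allowed so that the bound serves to construct runs step by step. *)
Lemma run_error : exists C h0 : R, [/\ 0 <= C, 0 < h0 &
  forall h N N' yn u, 0 < h <= h0 -> N%:R * h = T - t0 -> (N' <= N)%N ->
    run h N' y0 yn u ->
    (forall n, (n <= N')%N -> `|y (t h n) - yn n| <= 1) /\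
    forall n, (1 <= n <= N')%N ->
      (forall x, 0 <= x <= 1 ->
        `|y (t h n.-1 + x * h) - u n (x * h)| <= C * h ^+ s.+1) /\
      `|(y (t h n) - yn n) - (y (t h n.-1) - yn n.-1)| <= C * h ^+ (2 * s).+1].
Proof.
have [C [h1 [C0 h1_gt0 H]]] := run_step_error.
pose E := expR (C * (T - t0)).
have E1 : 1 <= E by rewrite -expR0 ler_expR mulr_ge0 // subr_ge0 ltW.
have E0 : 0 < E by exact: expR_gt0.
exists (C * (E + 1)), (Num.min h1 (Num.min 1 E^-1)); split.
- by rewrite mulr_ge0 // addr_ge0 // ltW.
- by rewrite !lt_min h1_gt0 ltr01 invr_gt0.
move=> h N N' yn u /andP[h0]; rewrite !le_min => /and3P[hh1 hle1 hE] Nh NN' ru.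
have hh : 0 < h <= h1 by rewrite h0.
have hX p : 0 <= h ^+ p by rewrite exprn_ge0 // ltW.
have s1 : (1 <= 2 * s)%N by rewrite muln_gt0.
have s2 : (s.+1 <= 2 * s)%N by rewrite mul2n -addnn -addn1 leq_add2l.
have h2s : E * h ^+ (2 * s) <= 1.
  rewrite mulrC -ler_pdivlMr // div1r (le_trans _ hE) // -[leRHS]expr1.
  by rewrite ler_wiXn2l ?(ltW h0).
(* (1 + C h)^n <= exp (C h n) <= exp (C (T - t0)). *)
have growth n : (n <= N)%N -> (1 + C * h) ^+ n <= E.
  move=> nN; have Ch : 0 <= C * h by rewrite mulr_ge0 // ltW.
  apply: (@le_trans _ _ (expR (C * h) ^+ n)).
    by rewrite lerXn2r ?nnegrE ?expR_ge0 ?addr_ge0 // expR_ge1Dx.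
  rewrite -expRM_natr ler_expR -mulrA ler_wpM2l // -Nh mulrC.
  by rewrite ler_wpM2r ?(ltW h0) // ler_nat.
have err n : (n <= N')%N ->
    `|y (t h n) - yn n| <= ((1 + C * h) ^+ n - 1) * h ^+ (2 * s).
  elim: n => [|n IHn] nN'.
    by rewrite mul0r addr0 Hy.1 (run_init ru) subrr normr0 expr0 subrr mul0r.
  have nN : (n <= N)%N by rewrite (leq_trans _ NN') // ltnW.
  have en := IHn (ltnW nN').
  have en1 : `|y (t h n) - yn n| <= 1.
    rewrite (le_trans en) // (le_trans _ h2s) // ler_wpM2r //.
    by rewrite (le_trans _ (growth n nN)) // gerBl.
  have [_] := H h N N' yn u hh Nh NN' ru n.+1 nN' en1; rewrite /= => st.
  rewrite -[y _ - _](subrK (y (t h n) - yn n)) (le_trans (ler_normD _ _)) //.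
  have : C * h * `|y (t h n) - yn n| <=
      C * h * (((1 + C * h) ^+ n - 1) * h ^+ (2 * s)).
    by rewrite ler_wpM2l // mulr_ge0 // ltW.
  rewrite exprS; move: st en; rewrite !mulrDr; lra.
have errE n : (n <= N')%N -> `|y (t h n) - yn n| <= E * h ^+ (2 * s).
  move=> nN'; rewrite (le_trans (err n nN')) // ler_wpM2r //.
  by rewrite (le_trans _ (growth n (leq_trans nN' NN'))) // gerBl.
have err1 n : (n <= N')%N -> `|y (t h n) - yn n| <= 1.
  by move=> nN'; rewrite (le_trans (errE n nN')).
split=> // n n1; have /andP[n0 nN'] := n1.
have n1N' : (n.-1 <= N')%N by rewrite (leq_trans (leq_pred _)).
have [Hx Hs1] := H h N N' yn u hh Nh NN' ru n n1 (err1 _ n1N').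
have en := errE _ n1N'; split=> [x x01|].
  rewrite (le_trans (Hx x x01)) // -mulrA ler_wpM2l // mulrDl mul1r lerD2r.
  by rewrite (le_trans en) // ler_wpM2l ?(ltW E0) // ler_wiXn2l ?(ltW h0).
rewrite (le_trans Hs1) // -mulrA ler_wpM2l // exprS mulrCA ler_wpM2l ?(ltW h0) //.
by rewrite mulrDl mul1r lerD2r.
Qed.

Lemma class_C1 : class_C 1 f.
Proof. by apply: class_C_le Hf; lia. Qed.

Lemma base_bound (h : R) N n (a : 'rV[R]_m) : 0 < h -> N%:R * h = T - t0 ->
  (n <= N)%N -> `|y (t h n) - a| <= 1 -> `|a| <= B0 + 1.
Proof.
move=> h0 Nh nN ya; rewrite -(subKr (y (t h n)) a) (le_trans (ler_normB _ _)) //.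
rewrite lerD // yB //; have nh : n%:R * h <= N%:R * h.
  by rewrite ler_wpM2r ?(ltW h0) ?ler_nat.
by apply/andP; split; [rewrite lerDl mulr_ge0 ?ler0n ?(ltW h0) | lra].
Qed.

(** A truncated run stays within distance 1 of the solution, hence in a ball on
    which the next step is solvable for a common range of h. *)
Lemma run_exists c2 : 0 < c2 -> (forall x, nrm x <= c2 * `|x|) ->
  exists2 h0 : R, 0 < h0 & forall h N, 0 < h <= h0 ->
  N%:R * h = T - t0 -> exists yn u, run h N y0 yn u.
Proof.
have [C [h1 [C0 h1_gt0 He]]] := run_error.
move=> c2_gt0 nrm_le; have r0 : 0 < rho / c2 by rewrite divr_gt0.
have [h2 h2_gt0 Hx] := slopes_exist P s b c01 class_C1 (B0 + 1) r0.
exists (Num.min h1 h2) => [|h N /andP[h0]]; first by rewrite lt_min h1_gt0.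
rewrite le_min => /andP[hh1 hh2] Nh.
suff H N' : (N' <= N)%N -> exists yn u, run h N' y0 yn u by exact: H.
elim: N' => [_|n IHn nN].
  by exists (fun=> y0), (fun _ _ => 0); split=> // -[|n].
have [yn [u ru]] := IHn (ltnW nN).
have hh1' : 0 < h <= h1 by rewrite h0.
have [e1 _] := He h N n yn u hh1' Nh (ltnW nN) ru.
have ynB := base_bound h0 Nh (ltnW nN) (e1 n (leqnn n)).
have [|g gE gN] := Hx h _ _ ynB; first by rewrite h0.
apply: (run_extend h0 ru gE) => x x01.
rewrite (le_trans (nrm_le _)) // mulrC -ler_pdivlMr //.
exact: gN.
Qed.

Lemma run_unique : exists2 h0 : R, 0 < h0 & forall h N yn u yn' u',
  0 < h <= h0 -> N%:R * h = T - t0 -> run h N y0 yn u -> run h N y0 yn' u' ->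
  forall n, (1 <= n <= N)%N ->
    yn n = yn' n /\ forall x, 0 <= x <= 1 -> u n (x * h) = u' n (x * h).
Proof.
have [C [h1 [C0 h1_gt0 He]]] := run_error.
have [h2 h2_gt0 Hu] := slopes_unique P s b c01 class_C1 B.
exists (Num.min h1 h2) => [|h N yn u yn' u' /andP[h0]]; first by rewrite lt_min h1_gt0.
rewrite le_min => /andP[hh1 hh2] Nh ru ru'.
have hh1' : 0 < h <= h1 by rewrite h0.
have [e1 _] := He h N N yn u hh1' Nh (leqnn N) ru.
have step n : (1 <= n <= N)%N -> yn n.-1 = yn' n.-1 ->
    yn n = yn' n /\ forall x, 0 <= x <= 1 -> u n (x * h) = u' n (x * h).
  move=> n1 Ey; have [g [gE uE ynE]] := run_stage c01 ru n1.
  have [g' [g'E u'E yn'E]] := run_stage c01 ru' n1.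
  have nN : (n.-1 <= N)%N by rewrite (leq_trans (leq_pred _)) //; case/andP: n1.
  have ynB := base_bound h0 Nh nN (e1 _ nN).
  have Eg : g = g'.
    apply: (Hu h (yn n.-1)) => //; first by rewrite h0.
    - by rewrite Ey.
    - move=> x x01; apply: (near_norm ynB).
      by rewrite -uE //; exact: (run_near ru n1).
    - move=> x x01; apply: (near_norm ynB).
      by rewrite Ey -u'E //; exact: (run_near ru' n1).
  split=> [|x x01]; first by rewrite ynE yn'E Ey Eg.
  by rewrite uE // u'E // Ey Eg.
have Eyn n : (n <= N)%N -> yn n = yn' n.
  elim: n => [_|n IHn nN]; first by rewrite (run_init ru) (run_init ru').
  by have [] := step n.+1 nN (IHn (ltnW nN)).
move=> n n1; apply: step => //; apply: Eyn.
by rewrite (leq_trans (leq_pred _)) //; case/andP: n1.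
Qed.

End Global.

Theorem theorem10 (R : realType) (m : nat) (nrm : 'rV[R]_m -> R)
  (f : 'rV[R]_m -> 'rV[R]_m) (t0 T : R) (y0 : 'rV[R]_m) (y : R -> 'rV[R]_m)
  (P : nat -> {poly R}) (s k q : nat) (c b : 'I_k -> R) (rho : R)
  (Hnrm : vector_norm nrm)
  (Hs : (1 <= s)%N)
  (Hf : class_C (2 * s) f)
  (HT : t0 < T)
  (Hy : ivp_solution f t0 T y0 y)
  (HP : legendre_basis P)
  (Hquad : interpolatory_quadrature c b)
  (Hord : quadrature_order c b q)
  (Hq : (2 * s <= q)%N)
  (Hrho : 0 < rho) :
  exists C : R, \forall N \near \oo,
    let h := (T - t0) / N%:R in
    let t := fun n : nat => t0 + n%:R * h in
    scheme_well_defined nrm f P s c b rho h N y0 /\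
    forall (yn : nat -> 'rV[R]_m) (u : nat -> R -> 'rV[R]_m),
      scheme_run nrm f P s c b rho h N y0 yn u ->
      forall n, (1 <= n <= N)%N ->
        nrm ((y (t n) - yn n) - (y (t n.-1) - yn n.-1)) <= C * h ^+ (2 * s + 1)
        /\
        exists2 M : R,
          is_maximum [set nrm (y (t n.-1 + x * h) - u n (x * h)) |
                       x in `[0, 1]] M
          & M <= C * h ^+ (s + 1).
Proof.
have c01 := abscissae_unit Hquad.
have [B0 _ yB] := solution_bounded Hy.2.
have [c2 c2_gt0 nrm_le] := vector_norm_le_max Hnrm.
have [c1 c1_gt0 le_nrm] := max_le_vector_norm Hnrm.
have [C [h1 [C0 h1_gt0 He]]] :=
  run_error Hs Hf HT Hy HP c01 Hord Hq Hrho yB le_nrm c1_gt0.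
have [h2 h2_gt0 Hex] :=
  run_exists Hs Hf HT Hy HP c01 Hord Hq Hrho yB le_nrm c1_gt0 c2_gt0 nrm_le.
have [h3 h3_gt0 Hun] :=
  run_unique Hs Hf HT Hy HP c01 Hord Hq Hrho yB le_nrm c1_gt0.
(* One threshold on h for the error bound, existence and uniqueness. *)
pose hmin := Num.min h1 (Num.min h2 h3).
have hmin_gt0 : 0 < hmin by rewrite !lt_min h1_gt0 h2_gt0.
have Nlarge : \forall N \near \oo, (0 < N)%N /\ (T - t0) / hmin <= N%:R.
  by apply: filterI; [exact: nbhs_infty_gt | exact: nbhs_infty_ger].
exists (c2 * C); apply: filterS Nlarge => N [N_gt0 Nhmin].
set h := (T - t0) / N%:R; pose t n := t0 + n%:R * h.
have N0 : 0 < N%:R :> R by rewrite ltr0n.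
have TmT : 0 < T - t0 by rewrite subr_gt0.
have h_gt0 : 0 < h by rewrite divr_gt0.
have Nh : N%:R * h = T - t0 by rewrite mulrC divfK // gt_eqF.
have : h <= hmin.
  by rewrite /h ler_pdivrMr // mulrC -ler_pdivrMr.
rewrite !le_min => /and3P[hh1 hh2 hh3].
have {}hh1 : 0 < h <= h1 by rewrite h_gt0.
have {}hh2 : 0 < h <= h2 by rewrite h_gt0.
have {}hh3 : 0 < h <= h3 by rewrite h_gt0.
split; first split.
- exact: Hex.
- move=> yn u yn' u'; exact: Hun.
move=> yn u ru n n1.
have [_ En] := He h N N yn u hh1 Nh (leqnn N) ru; have [Ex Estep] := En n n1.
split.
  rewrite (le_trans (nrm_le _)) // -mulrA ler_wpM2l ?(ltW c2_gt0) // addn1.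
  exact: Estep.
have [g [gE uE _]] := run_stage c01 ru n1.
pose w x := nrm (y (t n.-1 + x * h) - stage P (yn n.-1) h g x).
have wE x : 0 <= x <= 1 -> nrm (y (t n.-1 + x * h) - u n (x * h)) = w x.
  by move=> x01; rewrite uE.
have cw : {within `[0, 1], continuous w}.
  apply: (within_continuous_comp (vector_norm_continuous Hnrm)).
  apply: within_continuousB.
    apply: (continuous_solution_rescaled Hy.2) => x x01.
    exact: (grid_in h_gt0 Nh n1 x01).
  by apply: continuous_subspaceT; exact: (continuous_stage gE).
have [z z01 zmax] := EVT_max ler01 cw.
move: (z01); rewrite in_itv /= => z01'.
exists (w z).
  split=> [|_ [x x01 <-]]; first by exists z => //; exact: wE.
  by rewrite wE; [exact: zmax | move: x01; rewrite /= in_itv].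
rewrite -wE // addn1 (le_trans (nrm_le _)) // -mulrA ler_wpM2l ?(ltW c2_gt0) //.
exact: Ex.
Qed.
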